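(* Let $R$ be an iterated local skew power series ring in the ordered list of variables $x_1,\dots,x_n$ of type (A) or (B), and let $\preceq$ be a monomial order on $R$. Let $0\ne f\in R$. Then there are unique elements $u\in R^\times$ and $F\in R$ satisfying (i) $f=uF$ (and so $\mathrm{LM}(f)=\mathrm{LM}(F)$), (ii) $\mathrm{LC}(F)=1$, (iii) $\mathrm{supp}(F)\cap(\mathrm{LM}(f)+\mathbb{N}^n)=\{\mathrm{LM}(f)\}$.
   Context: $\mathbb{N}$ contains $0$. A skew derivation on a ring $B$ is a pair $(\sigma,\delta)$ with $\sigma$ an automorphism of $B$ and $\delta:B\to B$ additive with $\delta(rs)=\delta(r)s+\sigma(r)\delta(s)$. If $(B,\mathfrak m)$ is a complete local ring, $(\sigma,\delta)$ is local if $\sigma(\mathfrak m^i)=\mathfrak m^i$ and $\delta(\mathfrak m^i)\subseteq\mathfrak m^{i+1}$ for all $i\ge 0$; then the skew power series ring $B[[x;\sigma,\delta]]$ exists: it is the left $B$-module of formal power series $\sum_j b_jx^j$ with the continuous multiplication extending $xr=\sigma(r)x+\delta(r)$ $(r\in B)$, and it is again complete local. If $A\subseteq B$ is a subring, $(\sigma,\delta)$ is $A$-linear if $\sigma(a)=a$ and $\delta(a)=0$ for all $a\in A$. The ring $R$ is one of the following. Case (A): $A=k$ is a finite field of characteristic $p$, $R_0=A$, and for $1\le i\le n$, $R_i=R_{i-1}[[x_i;\sigma_i,\delta_i]]$ with $(\sigma_i,\delta_i)$ a local, $A$-linear skew derivation on $R_{i-1}$. Put $R=R_n$. Case (B): $A$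 is a (commutative) complete discrete valuation ring of characteristic $0$, not a field, with residue field $k$ a finite field of characteristic $p$; $x_1$ is a fixed uniformiser of $A$; $R_1=A$, and for $2\le i\le n$, $R_i=R_{i-1}[[x_i;\sigma_i,\delta_i]]$ with $(\sigma_i,\delta_i)$ a local, $A$-linear skew derivation on $R_{i-1}$. Put $R=R_n$. Let $\iota:k\to A$ be the unique multiplicative section of $A\to k$ (the identity in case (A)). For $\alpha\in\mathbb{N}^n$ write $x^\alpha=x_1^{\alpha_1}\cdots x_n^{\alpha_n}$. Every $r\in R$ is uniquely $r=\sum_{\alpha\in\mathbb{N}^n}r_\alpha x^\alpha$ with $r_\alpha\in\iota(k)$; $\mathrm{supp}(r)=\{\alpha:r_\alpha\ne0\}$. An additive total order on $\mathbb{N}^n$ is a total order with $0\prec\alpha$ for all $\alpha\neq 0$, and $\alpha\prec\beta\Rightarrow\alpha+\gamma\prec\beta+\gamma$ (it is automatically a well-order). For $r\ne0$, $\mathrm{LM}(r)=\min_\preceq\mathrm{supp}(r)$ and $\mathrm{LC}(r)=r_{\mathrm{LM}(r)}$. A monomial order on $R$ is an additive total order $\preceq$ with $\mathrm{LM}_\preceq(x^\alpha x^\beta)=\alpha+\beta$ for all $\alpha,\beta\in\mathbb{N}^n$. *)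

(* Defs.v *)
From HB Require Import structures.
From mathcomp Require Import all_boot all_order all_algebra.
From mathcomp Require Import boolp classical_sets functions.

Set Implicit Arguments.
Unset Strict Implicit.
Unset Printing Implicit Defensive.

Import GRing.Theory.
Local Open Scope classical_set_scope.
Local Open Scope ring_scope.

(* The rings R_i of the tower are subrings of the last one, R, given as subsets
   of R: a ring B below is a subset of an ambient ring, usually assumed to
   satisfy subring_closed.  Maps B -> B are total functions on the ambient ring
   of which only the values on B matter. *)

Section LocalRings.
Variable R : nzRingType.
Implicit Types (B I J : set R).

Definition unit_in B (b : R) : Prop :=
  B b /\ exists c, [/\ B c, b * c = 1 & c * b = 1].

Definition ideal B I : Prop :=
  [/\ I `<=` B, I 0,
      (forall a b, I a -> I b -> I (a - b)),
      (forall b a, B b -> I a -> I (b * a)) &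
      (forall b a, B b -> I a -> I (a * b))].

(* the non-units of B, which are its maximal ideal when B is local *)
Definition maxideal B : set R := [set b | B b /\ ~ unit_in B b].

Definition local_ring B : Prop :=
  subring_closed (mem B) /\ ideal B (maxideal B).

Definition ideal_prod I J : set R :=
  [set r | exists (l : nat) (a b : 'I_l -> R),
     (forall i, I (a i) /\ J (b i)) /\ r = \sum_i a i * b i].

Fixpoint maxideal_pow B (l : nat) : set R :=
  if l is l'.+1 then ideal_prod (maxideal B) (maxideal_pow B l') else B.

(* separated and complete for the topology with the powers of the maximal ideal
   as basic neighbourhoods of 0 *)
Definition complete_local_ring B : Prop :=
  [/\ local_ring B,
      (forall b, (forall l, maxideal_pow B l b) -> b = 0) &
      (forall s : nat -> R, (forall i, B (s i)) ->
         (forall l, exists N, forall i j, (N <= i)%N -> (N <= j)%N ->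
            maxideal_pow B l (s i - s j)) ->
         exists2 b, B b & forall l, exists N, forall i, (N <= i)%N ->
            maxideal_pow B l (s i - b))].

End LocalRings.

Section SkewPowerSeries.
Variable R : nzRingType.
Implicit Types (B S : set R) (x : R) (sigma delta : R -> R).

Definition automorphism_of B sigma : Prop :=
  [/\ set_bij B B sigma,
      {in B &, {morph sigma : a b / a + b}},
      {in B &, {morph sigma : a b / a * b}} &
      sigma 1 = 1].

Definition skew_derivation B sigma delta : Prop :=
  [/\ automorphism_of B sigma,
      set_fun B B delta,
      {in B &, {morph delta : a b / a + b}} &
      {in B &, forall r s, delta (r * s) = delta r * s + sigma r * delta s}].

Definition local_skew_derivation B sigma delta : Prop :=
  [/\ skew_derivation B sigma delta,
      (forall i, sigma @` maxideal_pow B i = maxideal_pow B i) &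
      (forall i, delta @` maxideal_pow B i `<=` maxideal_pow B i.+1)].

Definition linear_over (A : set R) sigma delta : Prop :=
  forall a, A a -> sigma a = a /\ delta a = 0.

(* The map c, s |-> (b_j)_j, identifies S with the left B-module of formal
   power series \sum_j b_j x^j. *)
Definition power_series_coefs B S x (c : R -> nat -> R) : Prop :=
  [/\ set_bij S [set b : nat -> R | forall j, B (b j)] c,
      (forall s t, S s -> S t -> forall j, c (s + t) j = c s j + c t j),
      (forall b s, B b -> S s -> forall j, c (b * s) j = b * c s j) &
      (forall i j, c (x ^+ i) j = (j == i)%:R)].

(* basic neighbourhoods of 0 in S for the product, over the coefficients, of
   the maximal-ideal-adic topology of B *)
Definition series_nbhs B S (c : R -> nat -> R) (l : nat) : set R :=
  [set s | S s /\ forall j, (j < l)%N -> maxideal_pow B l (c s j)].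

Definition continuous_mul B S (c : R -> nat -> R) : Prop :=
  forall s t, S s -> S t -> forall l, exists m, forall s' t', S s' -> S t' ->
    series_nbhs B S c m (s' - s) -> series_nbhs B S c m (t' - t) ->
    series_nbhs B S c l (s' * t' - s * t).

(* S = B[[x; sigma, delta]] *)
Definition skew_power_series_ring B S x sigma delta : Prop :=
  [/\ complete_local_ring B /\ local_skew_derivation B sigma delta,
      [/\ subring_closed (mem S), B `<=` S & S x],
      (forall r, B r -> x * r = sigma r * x + delta r) &
      exists2 c, power_series_coefs B S x c & continuous_mul B S c].

(* R is obtained from its subring A by adjoining successively the variables
   x i with d <= i: R_ d = A, and R_ i.+1 = (R_ i)[[x i; sigma i, delta i]]. *)
Definition iterated_skew_power_series (A : set R) (d n : nat) (x : 'I_n -> R) :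
    Prop :=
  exists (R_ : nat -> set R) (sigma delta : nat -> R -> R),
    [/\ R_ d = A, R_ n = [set: R] &
      forall i : 'I_n, (d <= i)%N ->
        skew_power_series_ring (R_ i) (R_ i.+1) (x i) (sigma i) (delta i) /\
        linear_over A (sigma i) (delta i)].

End SkewPowerSeries.

Definition complete_dvr (A : idomainType) : Prop :=
  [/\ complete_local_ring [set: A],
      (forall I, ideal [set: A] I -> exists a, I = range (fun b => a * b)) &
      exists2 a : A, a != 0 & ~ unit_in [set: A] a].

Definition uniformiser (A : idomainType) (a : A) : Prop :=
  maxideal [set: A] = range (fun b => a * b).

(* The coefficient ring A embeds in R by emb, and res is the projection of A to
   its residue field k.  The variables are indexed from 0. *)
Section Types.
Variables (k : finFieldType) (A : idomainType) (R : unitRingType).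
Variables (emb : {rmorphism A -> R}) (res : {rmorphism A -> k}).
Variables (n : nat) (x : 'I_n -> R).

(* A = k, by means of res *)
Definition type_A : Prop :=
  bijective res /\ iterated_skew_power_series (range emb) 0 x.

Definition type_B : Prop :=
  [/\ complete_dvr A /\ [pchar A] =i pred0,
      injective emb,
      set_surj [set: A] [set: k] res /\
        (forall a, res a = 0 <-> maxideal [set: A] a),
      (exists2 i0 : 'I_n, i0 = 0%N :> nat &
         exists2 a, uniformiser a & x i0 = emb a) &
      iterated_skew_power_series (range emb) 1 x].

End Types.

Definition multiplicative_section (k : finFieldType) (A : idomainType)
    (res : {rmorphism A -> k}) (iota : k -> A) : Prop :=
  {morph iota : a b / a * b} /\ cancel iota res.

Notation expo n := {ffun 'I_n -> nat}.

Section Monomials.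
Variables (k : finFieldType) (A : idomainType) (R : unitRingType).
Variables (emb : {rmorphism A -> R}) (iota : k -> A).
Variables (n : nat) (x : 'I_n -> R).

(* an ordered product: R is not commutative *)
Definition xmon (alpha : expo n) : R := \prod_(i < n) x i ^+ alpha i.

(* r is the sum of the family (c alpha) x^alpha, with all c alpha in iota(k):
   the finite partial sums converge to r in the topology of R given by the
   powers of its maximal ideal. *)
Definition expansion (r : R) (c : expo n -> A) : Prop :=
  (forall alpha, range iota (c alpha)) /\
  forall l, exists s0 : seq (expo n), forall s : seq (expo n),
    uniq s -> {subset s0 <= s} ->
    maxideal_pow [set: R] l
      (r - \sum_(alpha <- s) emb (c alpha) * xmon alpha).

(* Each r has exactly one expansion; the default value 0 is not used. *)
Definition coef (r : R) : expo n -> A := xget (fun=> 0) [set c | expansion r c].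

Definition supp (r : R) : set (expo n) := [set alpha | coef r alpha != 0].

Definition strict (le : rel (expo n)) : rel (expo n) :=
  fun alpha beta => (alpha != beta) && le alpha beta.

Definition additive_total_order (le : rel (expo n)) : Prop :=
  [/\ total le, antisymmetric le, transitive le,
      (forall alpha, alpha != 0 -> strict le 0 alpha) &
      (forall alpha beta gamma, strict le alpha beta ->
         strict le (alpha + gamma) (beta + gamma))].

(* the least element of supp r; junk value 0 when r = 0 *)
Definition LM (le : rel (expo n)) (r : R) : expo n :=
  xget 0 [set alpha | supp r alpha /\ forall beta, supp r beta -> le alpha beta].

Definition LC (le : rel (expo n)) (r : R) : A := coef r (LM le r).

Definition monomial_order (le : rel (expo n)) : Prop :=
  additive_total_order le /\
  forall alpha beta, LM le (xmon alpha * xmon beta) = alpha + beta.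

End Monomials.

(* Main.v *)
Require Import Defs.
From HB Require Import structures.
From mathcomp Require Import all_boot all_order all_algebra.
From mathcomp Require Import boolp classical_sets functions.
Import GRing.Theory.
Local Open Scope classical_set_scope.
Local Open Scope ring_scope.

Set Implicit Arguments.
Unset Strict Implicit.
Unset Printing Implicit Defensive.

(* At each step S = B[[x; sigma, delta]] of the tower, the l-th power of the
   maximal ideal of S consists of the series whose j-th coefficient lies in the
   (l-j)-th power of that of B.  Hence the ordered monomials of degree j form a
   basis of m^j/m^(j+1) over k, and expansions exist and are unique.  Expansions
   do not add digit by digit in type (B), but a carry only moves towards larger
   exponents; so the elements with support above a given exponent form a
   subgroup, LM(q f) = LM(q) + LM(f), and LM(g - g') is the least exponent at
   which the digits of g and g' differ.

   Let mu = LM(f) and D = mu + N^n.  Uniqueness: if F and v F are solutions and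
   v <> 1, their digits agree on D, while LM((v - 1) F) = LM(v - 1) + mu lies in
   D.  Existence: the order is a well-order by Dickson's lemma, and recursion
   along it produces the digits of an element q such that q f has prescribed
   digits on D, the digit of q at beta being adjusted to obtain the digit of q f
   at beta + mu.  Prescribing 1 at mu and 0 elsewhere on D forces LM(q) = 0, so
   that q is a unit. *)

(** * Powers of the maximal ideal *)

(** Subrings, ideals, their powers and the filtration [fil] below are all of this kind; [I (a - b)]
    then serves as congruence of [a] and [b] modulo [I]. *)
Definition additive_subgroup (V : zmodType) (I : set V) : Prop :=
  I 0 /\ forall a b, I a -> I b -> I (a - b).

Section AdditiveSubgroups.
Variables (V : zmodType) (I : set V).
Hypothesis addI : additive_subgroup I.

Lemma asub0 : I 0. Proof. by case: addI. Qed.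

Lemma asubB a b : I a -> I b -> I (a - b).
Proof. by case: addI => _; apply. Qed.

Lemma asubN a : I a -> I (- a).
Proof. by move=> Ia; rewrite -[- a]add0r; apply: asubB => //; exact: asub0. Qed.

Lemma asubD a b : I a -> I b -> I (a + b).
Proof. by move=> Ia Ib; rewrite -[b]opprK; apply/asubB/asubN. Qed.

Lemma asub_sum (T : Type) (s : seq T) (P : pred T) (F : T -> V) :
  (forall i, P i -> I (F i)) -> I (\sum_(i <- s | P i) F i).
Proof. by move=> IF; elim/big_ind: _ => //; [exact: asub0 | exact: asubD]. Qed.

Lemma asub_trans b a c : I (a - b) -> I (b - c) -> I (a - c).
Proof. by move=> ab bc; rewrite -(subrKA b a (- c)); apply: asubD. Qed.

Lemma asub_sym a b : I (a - b) -> I (b - a).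
Proof. by move=> ab; rewrite -opprB; apply: asubN. Qed.

Lemma asub_congr a b : I (a - b) -> I b -> I a.
Proof. by move=> ab bI; rewrite -(subrK b a); apply: asubD. Qed.

End AdditiveSubgroups.

Section Ideals.
Variable R : nzRingType.
Implicit Types (B I J K : set R).

Lemma subring_asub B : subring_closed (mem B) -> additive_subgroup B.
Proof.
move=> [B1 BB _]; split=> [|a b Ba Bb].
  by have := BB 1 1 B1 B1; rewrite subrr inE.
by have := BB a b; rewrite !inE; apply.
Qed.

Lemma subring_one B : subring_closed (mem B) -> B 1.
Proof. by case=> + _ _; rewrite inE. Qed.

Lemma subring_mul B a b : subring_closed (mem B) -> B a -> B b -> B (a * b).
Proof. by case=> _ _ /(_ a b); rewrite !inE; apply. Qed.

Lemma subring_exp B a n : subring_closed (mem B) -> B a -> B (a ^+ n).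
Proof.
move=> sB Ba; elim: n => [|n IHn]; first by rewrite expr0; exact: subring_one.
by rewrite exprS; apply: subring_mul.
Qed.

Lemma subring_prod B (T : Type) (s : seq T) (P : pred T) (F : T -> R) :
  subring_closed (mem B) -> (forall i, P i -> B (F i)) ->
  B (\prod_(i <- s | P i) F i).
Proof.
move=> sB BF; elim/big_ind: _ => // [|a b]; first exact: subring_one.
exact: subring_mul.
Qed.

Lemma ideal_asub B I : ideal B I -> additive_subgroup I.
Proof. by case=> _ I0 IB _ _. Qed.

Lemma ideal_prod_mul I J a b : I a -> J b -> ideal_prod I J (a * b).
Proof.
by move=> Ia Jb; exists 1%N, (fun=> a), (fun=> b); split=> //; rewrite big_ord1.
Qed.

Lemma ideal_prod_sub I J K : additive_subgroup K ->
  (forall a b, I a -> J b -> K (a * b)) -> ideal_prod I J `<=` K.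
Proof.
move=> addK IJK r [l [a [b [ab ->]]]].
by apply: asub_sum => // i _; have [] := ab i; exact: IJK.
Qed.

Lemma ideal_prod_ideal B I J : subring_closed (mem B) ->
  ideal B I -> ideal B J -> ideal B (ideal_prod I J).
Proof.
move=> sB [IB I0 IBB IBl IBr] [JB J0 JBB JBl JBr].
have addB := subring_asub sB.
split.
- apply: ideal_prod_sub => // a b /IB Ba /JB Bb; exact: subring_mul.
- exists 0%N, (fun=> 0), (fun=> 0); split=> [[]//|]; by rewrite big_ord0.
- move=> _ _ [l [a [b [ab ->]]]] [l' [a' [b' [ab' ->]]]].
  (* The two sums are concatenated; the minus sign goes to the left factors of the second. *)
  exists (l + l')%N,
    (fun i : 'I_(l + l') =>
       match fintype.split i with inl j => a j | inr j => - a' j end),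
    (fun i : 'I_(l + l') =>
       match fintype.split i with inl j => b j | inr j => b' j end).
  split=> [i|].
    case: (fintype.split i) => j; first exact: ab.
    have [Ia' Jb'] := ab' j; split=> //.
    by rewrite -[- _]add0r; apply: IBB.
  rewrite big_split_ord /=; congr (_ + _).
    apply: eq_bigr => i _; by rewrite -[lshift _ _]/(unsplit (inl i)) unsplitK.
  rewrite -sumrN; apply: eq_bigr => i _.
  by rewrite -[rshift _ _]/(unsplit (inr i)) unsplitK mulNr.
- move=> c _ Bc [l [a [b [ab ->]]]].
  exists l, (fun i => c * a i), b; split=> [i|].
    by have [Ia Jb] := ab i; split=> //; apply: IBl.
  by rewrite mulr_sumr; apply: eq_bigr => i _; rewrite mulrA.
- move=> c _ Bc [l [a [b [ab ->]]]].
  exists l, a, (fun i => b i * c); split=> [i|].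
    by have [Ia Jb] := ab i; split=> //; apply: JBr.
  by rewrite mulr_suml; apply: eq_bigr => i _; rewrite mulrA.
Qed.

Section MaximalIdealPowers.
Variable B : set R.
Hypothesis locB : local_ring B.

Let sB : subring_closed (mem B). Proof. by case: locB. Qed.

Lemma maxideal_pow_ideal l : ideal B (maxideal_pow B l).
Proof.
case: locB => _ idm; elim: l => [|l IHl] /=; last exact: ideal_prod_ideal.
have addB := subring_asub sB.
split=> // [||b a Bb Ba|b a Bb Ba]; [exact: asub0|exact: asubB| |];
  exact: subring_mul.
Qed.

Lemma maxideal_pow_asub l : additive_subgroup (maxideal_pow B l).
Proof. exact: ideal_asub (maxideal_pow_ideal l). Qed.

Lemma maxideal_pow_sub l : maxideal_pow B l `<=` B.
Proof. by case: (maxideal_pow_ideal l). Qed.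

Lemma maxideal_pow_mull l a b :
  B a -> maxideal_pow B l b -> maxideal_pow B l (a * b).
Proof. by case: (maxideal_pow_ideal l) => _ _ _ + _; apply. Qed.

Lemma maxideal_pow_mulr l a b :
  maxideal_pow B l a -> B b -> maxideal_pow B l (a * b).
Proof. by move=> la Bb; case: (maxideal_pow_ideal l) => _ _ _ _; apply. Qed.

Lemma maxideal_pow_le l l' : (l <= l')%N ->
  maxideal_pow B l' `<=` maxideal_pow B l.
Proof.
move=> /subnKC <-; elim: (l' - l)%N => [|i IHi]; first by rewrite addn0.
rewrite addnS; apply: subset_trans IHi => /=.
apply: ideal_prod_sub; first exact: maxideal_pow_asub.
by move=> a b [Ba _]; exact: maxideal_pow_mull.
Qed.

Lemma maxideal_powD l l' a b : maxideal_pow B l a -> maxideal_pow B l' b ->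
  maxideal_pow B (l + l') (a * b).
Proof.
move=> la l'b; elim: l a la => [|l IHl] a /=.
  by rewrite add0n => Ba; exact: maxideal_pow_mull.
move=> [i [u [v [uv ->]]]]; rewrite mulr_suml.
apply: asub_sum; first exact: (maxideal_pow_asub (l + l').+1).
move=> j _; rewrite -mulrA; have [mu lv] := uv j.
by apply: ideal_prod_mul => //; apply: IHl.
Qed.

Lemma maxideal_pow1 : maxideal_pow B 1 = maxideal B.
Proof.
case: locB => _ idm; apply/seteqP; split=> [|a ma] /=.
  apply: ideal_prod_sub; first exact: ideal_asub idm.
  by case: idm => _ _ _ _ idr a b ma Bb; apply: idr.
by rewrite -[a]mulr1; apply: ideal_prod_mul => //; exact: subring_one.
Qed.

Lemma maxideal_powX l a : maxideal B a -> maxideal_pow B l (a ^+ l).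
Proof.
move=> ma; elim: l => [|l IHl]; first exact: (subring_one sB).
by rewrite exprS; apply: ideal_prod_mul.
Qed.

End MaximalIdealPowers.
End Ideals.

(** * One skew power series extension *)

Section SkewExtension.
Variables (R : nzRingType) (B S : set R) (x : R) (sigma delta : R -> R).
Variable c : R -> nat -> R.
Hypothesis complB : complete_local_ring B.
Hypothesis locd : local_skew_derivation B sigma delta.
Hypothesis sS : subring_closed (mem S).
Hypothesis BS : B `<=` S.
Hypothesis Sx : S x.
Hypothesis xE : forall r, B r -> x * r = sigma r * x + delta r.
Hypothesis psc : power_series_coefs B S x c.
Hypothesis contS : continuous_mul B S c.

Local Notation "''m^' l" := (maxideal_pow B l) (at level 8, l at level 2).

Let locB : local_ring B. Proof. by case: complB. Qed.
Let sB : subring_closed (mem B). Proof. by case: locB. Qed.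
Let addB : additive_subgroup B. Proof. exact: subring_asub. Qed.
Let addS : additive_subgroup S. Proof. exact: subring_asub. Qed.
Let addm l : additive_subgroup 'm^l. Proof. exact: maxideal_pow_asub. Qed.
Let SX i : S (x ^+ i). Proof. exact: subring_exp. Qed.
Let SM s t : S s -> S t -> S (s * t). Proof. exact: subring_mul. Qed.

Let cB s j : S s -> B (c s j).
Proof. by case: psc => -[+ _ _] _ _ _ => /(_ s) + Ss; apply. Qed.

Let c_inj s t : S s -> S t -> (forall j, c s j = c t j) -> s = t.
Proof.
case: psc => -[_ + _] _ _ _ => inj Ss St st.
by apply: inj; rewrite ?inE //; apply: funext.
Qed.

Let c_surj b : (forall j, B (b j)) -> exists2 s, S s & forall j, c s j = b j.
Proof.
case: psc => -[_ _ +] _ _ _ => surj Bb; have [s Ss sb] := surj b Bb.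
by exists s => // j; rewrite sb.
Qed.

Let cD s t j : S s -> S t -> c (s + t) j = c s j + c t j.
Proof. by case: psc => _ + _ _ => + Ss St; apply. Qed.

Let cM b s j : B b -> S s -> c (b * s) j = b * c s j.
Proof. by case: psc => _ _ + _ => + Ss St; apply. Qed.

Let c0 j : c 0 j = 0.
Proof.
have S0 := asub0 addS.
by have /eqP := cD j S0 S0; rewrite addr0 -subr_eq subrr eq_sym => /eqP.
Qed.

Let cN s j : S s -> c (- s) j = - c s j.
Proof.
move=> Ss; apply/eqP; rewrite -addr_eq0 -cD //; last exact: asubN.
by rewrite addNr c0.
Qed.

Let cBr s t j : S s -> S t -> c (s - t) j = c s j - c t j.
Proof. by move=> Ss St; rewrite cD ?cN //; exact: asubN. Qed.

Let c_sum (T : Type) (r : seq T) (P : pred T) (F : T -> R) j :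
  (forall i, P i -> S (F i)) ->
  c (\sum_(i <- r | P i) F i) j = \sum_(i <- r | P i) c (F i) j.
Proof.
move=> SF; suff [] : S (\sum_(i <- r | P i) F i) /\
  c (\sum_(i <- r | P i) F i) j = \sum_(i <- r | P i) c (F i) j by [].
apply: (big_rec2 (fun y z => S y /\ c y j = z)) => [|i z y Pi [Sy <-]].
  by split; [exact: asub0 | exact: c0].
by split; [apply: asubD => //; exact: SF | rewrite cD //; exact: SF].
Qed.

Let c_mon b i j : B b -> c (b * x ^+ i) j = b * (j == i)%:R.
Proof. by move=> Bb; rewrite cM //; case: psc => _ _ _ ->. Qed.

Let c_const b j : B b -> c b j = b * (j == 0%N)%:R.
Proof. by move=> Bb; rewrite -[b in LHS]mulr1 -(expr0 x) c_mon. Qed.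

Let trunc N s := \sum_(i < N) c s i * x ^+ i.

Let Smon b i : B b -> S (b * x ^+ i).
Proof. by move=> /BS Sb; apply: SM. Qed.

Let Strunc N s : S s -> S (trunc N s).
Proof. by move=> Ss; apply: asub_sum => // i _; apply/Smon/cB. Qed.

Let c_trunc N s j : S s -> c (trunc N s) j = if (j < N)%N then c s j else 0.
Proof.
move=> Ss; rewrite c_sum => [|i _]; last exact/Smon/cB.
under eq_bigr => i _ do rewrite (c_mon _ _ (cB _ Ss)) mulr_natr.
case: ltnP => jN; last first.
  rewrite big1 // => i _; case: eqP => // ji.
  by move: jN; rewrite ji leqNgt ltn_ord.
rewrite (bigD1 (Ordinal jN)) //= eqxx mulr1n big1 ?addr0 // => i /eqP ij.
by case: eqP => // ji; case: ij; apply: val_inj.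
Qed.

(* Identified below with the l-th power of the maximal ideal of S. *)
Let fil l : set R := [set s | S s /\ forall j, 'm^(l - j) (c s j)].

Let fil_asub l : additive_subgroup (fil l).
Proof.
split=> [|s t [Ss ls] [St lt]].
  by split=> [|j]; [exact: asub0 | rewrite c0; exact: asub0].
by split=> [|j]; [exact: asubB | rewrite cBr //; exact: asubB].
Qed.

Let fil0 : fil 0 = S.
Proof.
apply/seteqP; split=> [s []//|s Ss]; split=> // j; rewrite sub0n; exact: cB.
Qed.

Let fil_le l l' : (l <= l')%N -> fil l' `<=` fil l.
Proof.
move=> ll' s [Ss ls]; split=> // j; apply: (maxideal_pow_le locB) (ls j).
exact: leq_sub2r.
Qed.

Let fil_mon l b i : 'm^(l - i) b -> fil l (b * x ^+ i).
Proof.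
move=> lb; have Bb : B b by exact: (maxideal_pow_sub locB) lb.
split=> [|j]; first exact: Smon.
rewrite c_mon //; case: eqP => [->|_]; first by rewrite mulr1.
by rewrite mulr0; exact: asub0.
Qed.

Let fil_trunc N s : S s -> fil N (s - trunc N s).
Proof.
move=> Ss; split=> [|j]; first by apply: asubB => //; exact: Strunc.
rewrite cBr ?c_trunc //; last exact: Strunc.
case: ltnP => jN; first by rewrite subrr; exact: asub0.
by rewrite subr0 (eqP jN); exact: cB.
Qed.

Let fil_sep s : (forall l, fil l s) -> s = 0.
Proof.
move=> ls; have Ss : S s by case: (ls 0%N).
apply: c_inj => // [|j]; first exact: asub0.
rewrite c0; case: complB => _ sep _; apply: sep => l.
by have [_ /(_ j)] := ls (l + j)%N; rewrite addnK.
Qed.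

(** [fil] and [series_nbhs] define the same topology: for [j < m] an element of [fil (m + m)] has
    its [j]-th coefficient in the [m]-th power, while [fil l] asks of the coefficients from [l] on
    only that they lie in [B]. *)
Let fil_cont s t : S s -> S t -> forall l, exists m, forall s' t',
  fil m (s' - s) -> fil m (t' - t) -> fil l (s' * t' - s * t).
Proof.
move=> Ss St l; have [m cm] := contS Ss St l; exists (m + m)%N => s' t' ss' tt'.
have nbhs_fil u : fil (m + m) u -> series_nbhs B S c m u.
  move=> [Su lu]; split=> // j jm; apply: (maxideal_pow_le locB) (lu j).
  by rewrite -addnBA ?leq_addr // ltnW.
have Ss' : S s' by rewrite -(subrK s s'); apply: asubD => //; case: ss'.
have St' : S t' by rewrite -(subrK t t'); apply: asubD => //; case: tt'.
have [Su lu] := cm _ _ Ss' St' (nbhs_fil _ ss') (nbhs_fil _ tt').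
split=> // j; case: (ltnP j l) => jl; last by rewrite (eqP jl); exact: cB.
by apply: (maxideal_pow_le locB) (lu j jl); exact: leq_subr.
Qed.

(** By continuity [t] may be replaced by a truncation, and [x * (b * x ^+ i)] is
    [sigma b * x ^+ i.+1 + delta b * x ^+ i]. The first term gains a power of [x], the second a
    power of the maximal ideal through [delta]. *)
Let fil_xmul l t : fil l t -> fil l.+1 (x * t).
Proof.
move=> lt; have St : S t by case: lt.
have [m cm] := fil_cont Sx St l.+1.
have lx : fil m (x - x) by rewrite subrr; exact: asub0.
have ltr : fil m (trunc m t - t) by apply: asub_sym => //; exact: fil_trunc.
apply: (asub_congr _ (asub_sym _ (cm _ _ lx ltr))) => //.
rewrite mulr_sumr; apply: asub_sum => // i _.
have Bti := cB i St; case: locd => -[_ _ _ _] sm dm; case: (lt) => _ /(_ i) lti.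
rewrite mulrA xE // mulrDl -mulrA -exprS; apply: asubD => //; apply: fil_mon.
  by rewrite subSS -sm; exists (c t i).
have : 'm^((l - i).+1) (delta (c t i)) by apply: dm; exists (c t i).
by apply: (maxideal_pow_le locB); rewrite leq_subLR addnS ltnS -leq_subLR.
Qed.

Let fil_xnmul l i t : fil l t -> fil (l + i) (x ^+ i * t).
Proof.
elim: i t => [|i IHi] t lt; first by rewrite addn0 mul1r.
by rewrite addnS exprS -mulrA; apply/fil_xmul/IHi.
Qed.

Let fil_bmul a l b t : 'm^a b -> fil l t -> fil (a + l) (b * t).
Proof.
move=> ab [St lt]; have Bb : B b by exact: (maxideal_pow_sub locB) ab.
split=> [|j]; first by apply: SM => //; exact: BS.
rewrite cM //; have := maxideal_powD locB ab (lt j).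
apply: (maxideal_pow_le locB).
by rewrite leq_subLR addnCA leq_add2l -leq_subLR.
Qed.

(** By continuity [s] may be replaced by a truncation, whose term of index [i] acts on [t] by [i]
    multiplications by [x] and then one by an element of [B], each with a known gain. *)
Let fil_mul a b s t : fil a s -> fil b t -> fil (a + b) (s * t).
Proof.
move=> ls lt; have [Ss as_] := ls; have [St _] := lt.
have [m cm] := fil_cont Ss St (a + b).
have l0 : fil m (t - t) by rewrite subrr; exact: asub0.
have ltr : fil m (trunc m s - s) by apply: asub_sym => //; exact: fil_trunc.
apply: (asub_congr _ (asub_sym _ (cm _ _ ltr l0))) => //.
rewrite mulr_suml; apply: asub_sum => // i _; rewrite -mulrA.
have := fil_bmul (as_ i) (fil_xnmul i lt); apply: fil_le.
by rewrite [(a + b)%N]addnC addnCA leq_add2l addnC -leq_subLR.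
Qed.

Let fil_exp t i : fil 1 t -> fil i (t ^+ i).
Proof.
move=> t1; elim: i => [|i IHi]; first by rewrite fil0; exact: subring_one.
by rewrite exprS -add1n; apply: fil_mul.
Qed.

Let fil_mull l s t : S s -> fil l t -> fil l (s * t).
Proof. by rewrite -fil0 => s0 lt; rewrite -[l]add0n; apply: fil_mul. Qed.

Let fil_mulr l s t : fil l s -> S t -> fil l (s * t).
Proof. by rewrite -fil0 => s0 lt; rewrite -[l]addn0; apply: fil_mul. Qed.

Let fil_complete (s : nat -> R) : (forall i, S (s i)) ->
  (forall l, exists N, forall i j, (N <= i)%N -> (N <= j)%N ->
     fil l (s i - s j)) ->
  exists2 t, S t & forall l, exists N, forall i, (N <= i)%N -> fil l (s i - t).
Proof.
move=> Ss cau.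
have lim j : exists b, B b /\ forall l, exists N, forall i, (N <= i)%N ->
    'm^l (c (s i) j - b).
  case: complB => _ _ /(_ (fun i => c (s i) j)) [|l|b Bb lb].
  - by move=> i; exact: cB.
  - have [N Nl] := cau (l + j)%N; exists N => i i' Ni Ni'.
    by have [_ /(_ j)] := Nl i i' Ni Ni'; rewrite addnK cBr.
  - by exists b.
have [b /all_and2[Bb lb]] := choice lim.
have [t St tb] := c_surj Bb; exists t => // l.
have [N Nl] := choice (fun j => lb j l).
(* Limits are taken coefficient by coefficient, but modulo [fil l] only the indices below [l] count,
   so finitely many thresholds suffice. *)
exists (\max_(j < l) N j)%N => i Ni; split=> [|j]; first exact: asubB.
rewrite cBr // tb; case: (ltnP j l) => jl.
  apply: (maxideal_pow_le locB) (leq_subr j l) _ (Nl j i _).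
  exact: leq_trans (leq_bigmax (Ordinal jl)) Ni.
rewrite (eqP jl); apply: asubB => //; exact: cB.
Qed.

(** The inverse is the limit of the geometric sums [y N]. *)
Let fil_unit t : fil 1 t -> unit_in S (1 - t).
Proof.
move=> t1; have St : S t by case: t1.
have S1 := subring_one sS.
pose y N := \sum_(i < N) t ^+ i.
have Sy N : S (y N) by apply: asub_sum => // i _; exact: subring_exp.
have yE N : (1 - t) * y N = 1 - t ^+ N.
  by rewrite -opprB mulNr -subrX1 opprB.
have yE' N : y N * (1 - t) = 1 - t ^+ N.
  rewrite -yE mulrBl mulrBr mulr1 mul1r mulr_suml mulr_sumr.
  by congr (_ - _); apply: eq_bigr => i _; rewrite -exprS -exprSr.
have yD N i : fil N (y (N + i)%N - y N).
  rewrite /y -!(big_mkord predT (fun i => t ^+ i)) (big_cat_nat (n := N)) //=;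
    last exact: leq_addr.
  rewrite addrAC subrr add0r big_seq.
  apply: asub_sum => // j; rewrite mem_index_iota => /andP[Nj _].
  exact: fil_le Nj _ (fil_exp j t1).
have [|z Sz lz] := fil_complete Sy.
  move=> l; exists l => i j /subnKC <- /subnKC <-.
  by apply: (asub_trans (fil_asub l) (b := y l)) => //; apply: asub_sym.
have Slt : S (1 - t) by exact: asubB.
split=> //; exists z; split=> //; apply/eqP; rewrite -subr_eq0; apply/eqP;
    apply: fil_sep => l; have [N Nl] := lz l;
    have yz := Nl (N + l)%N (leq_addr _ _);
    have tl : fil l (t ^+ (N + l)) by apply: (fil_le (leq_addl N l));
      exact: fil_exp.
- have -> : (1 - t) * z - 1 = (1 - t) * (z - y (N + l)%N) - t ^+ (N + l).
    by rewrite mulrBr yE opprB addrA addrAC addrK.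
  by apply: asubB => //; apply: fil_mull => //; apply: asub_sym.
- have -> : z * (1 - t) - 1 = (z - y (N + l)%N) * (1 - t) - t ^+ (N + l).
    by rewrite mulrBl yE' opprB addrA addrAC addrK.
  by apply: asubB => //; apply: fil_mulr => //; apply: asub_sym.
Qed.

(** A series is a unit exactly when its constant coefficient is one: if [d] inverts that
    coefficient, then [1 - d * s] lies in [fil 1], and [fil_unit] makes [d * s] invertible. *)
Let maxideal_fil : maxideal S = fil 1.
Proof.
have B1 := subring_one sB; have S1 := subring_one sS.
apply/seteqP; split=> s [Ss]; last first.
  move=> s1; split=> // -[_ [t [St st _]]].
  have [_ /(_ 0%N)] : fil 1 (s * t) by apply: fil_mulr.
  rewrite st c_const // mulr1 subn0 maxideal_pow1 // => -[_]; apply.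
  by split=> //; exists 1; rewrite mulr1.
move=> nus; split=> // -[|j]; last by rewrite subSS sub0n; exact: cB.
rewrite subn0 maxideal_pow1 //; split=> [|[_ [d [Bd bd db]]]]; first exact: cB.
apply: nus; split=> //.
have Sd := BS Bd; have Sb := BS (cB 0 Ss); have Sds := SM Sd Ss.
have [|_ [z [Sz dsz zds]]] := @fil_unit (1 - d * s).
  split=> [|[|j]]; first exact: asubB.
    rewrite cBr // cM // c_const // mulr1 db subrr; exact: asub0.
  by rewrite subSS sub0n; apply: cB; exact: asubB.
rewrite subKr in dsz zds.
exists (z * d); split; [exact: SM | | by rewrite -mulrA].
(* With [b] the constant coefficient of [s], one has [s * z * d = b * (d * s * z) * d = b * d =
   1]. *)
rewrite mulrA -[s]mul1r -bd -!mulrA [d * (s * _)]mulrA [d * s * _]mulrA dsz.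
by rewrite mul1r.
Qed.

Let locS : local_ring S.
Proof.
split=> //; rewrite maxideal_fil; split.
- by move=> s [].
- exact: asub0.
- by move=> s t; exact: asubB.
- by move=> s t; exact: fil_mull.
- by move=> s t Ss /fil_mulr; exact.
Qed.

(** [w] has the coefficients of [s] shifted by [l]. The coefficients of [w * x ^+ l] are known
    directly only for [w] in [B], so the identity is checked on truncations, modulo every
    [fil N]. *)
Let c_shift l s : S s ->
  exists2 w, S w & s = trunc l s + w * x ^+ l.
Proof.
move=> Ss.
have [w Sw ws] := c_surj (fun j => cB (l + j) Ss).
exists w => //; apply/eqP; rewrite -subr_eq0 opprD addrA; apply/eqP.
apply: fil_sep => N.
pose v := \sum_(i < N) c s (l + i)%N * x ^+ (l + i).
have Sv : S v by apply: asub_sum => // i _; apply/Smon/cB.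
have -> : s - trunc l s - w * x ^+ l =
    (s - trunc (l + N) s) - (w - trunc N w) * x ^+ l.
  have -> : trunc (l + N) s = trunc l s + v by rewrite /trunc big_split_ord.
  have -> : v = trunc N w * x ^+ l.
    rewrite mulr_suml; apply: eq_bigr => i _.
    by rewrite ws -mulrA -exprD addnC.
  by rewrite mulrBl opprD opprB !addrA subrK.
apply: asubB => //; first exact: fil_le (leq_addl l N) _ (fil_trunc _ Ss).
by apply: fil_mulr => //; exact: fil_trunc.
Qed.

(** One inclusion is multiplicativity of [fil]. For the other, split off a tail [w * x ^+ l]: the
    remaining terms are products of an element of the [(l - i)]-th power of the maximal ideal of [B]
    and [x ^+ i], and [x] is in the maximal ideal of [S]. *)
Let maxideal_pow_fil l : maxideal_pow S l = fil l.
Proof.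
apply/seteqP; split.
  elim: l => [|l IHl]; first by rewrite fil0.
  apply: ideal_prod_sub => //= s t;
    rewrite maxideal_fil -[l.+1]add1n => s1 /IHl.
  exact: fil_mul.
have mx : maxideal S x.
  rewrite maxideal_fil -[x]mulr1; apply: fil_xmul.
  by rewrite fil0; exact: subring_one.
have mB i b : 'm^i b -> maxideal_pow S i b.
  elim: i b => [|i IHi] b; first exact: BS.
  apply: ideal_prod_sub; first exact: (maxideal_pow_asub locS i.+1).
  move=> a a' ma /IHi ma'; apply: ideal_prod_mul => //.
  rewrite maxideal_fil; split=> [|j]; first by case: ma => /BS.
  have Ba : B a by case: ma.
  rewrite c_const //; case: j => [|j]; last by rewrite mulr0; exact: asub0.
  by rewrite eqxx mulr1 subn0 maxideal_pow1.
move=> s [Ss ls]; have [w Sw ->] := c_shift l Ss.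
apply: asubD; first exact: maxideal_pow_asub.
  apply: asub_sum => [|i _]; first exact: maxideal_pow_asub.
  have := maxideal_powD locS (mB _ _ (ls i)) (maxideal_powX locS i mx).
  by rewrite subnK // ltnW.
by apply: maxideal_pow_mull => //; exact: maxideal_powX.
Qed.

Lemma skew_extension_complete : complete_local_ring S /\
  forall l s, maxideal_pow S l s <->
    S s /\ forall j, maxideal_pow B (l - j) (c s j).
Proof.
split=> [|l s]; last by rewrite maxideal_pow_fil.
split=> // [s ls|s Ss cau].
  by apply: fil_sep => l; rewrite -maxideal_pow_fil.
have [|t St lt] := fil_complete Ss.
  by move=> l; have [N Nl] := cau l; exists N => i j;
    rewrite -maxideal_pow_fil; exact: Nl.
by exists t => // l; have [N Nl] := lt l; exists N => i;
  rewrite maxideal_pow_fil; exact: Nl.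
Qed.

Lemma series_coef_sum (T : Type) (r : seq T) (P : pred T) (F : T -> R) j :
  (forall i, P i -> S (F i)) ->
  c (\sum_(i <- r | P i) F i) j = \sum_(i <- r | P i) c (F i) j.
Proof. exact: c_sum. Qed.

Lemma series_coef_monomial b i j : B b -> c (b * x ^+ i) j = b * (j == i)%:R.
Proof. exact: c_mon. Qed.

Lemma series_coef_mem s j : S s -> B (c s j).
Proof. exact: cB. Qed.

Lemma series_coef_truncation N s : S s ->
  maxideal_pow S N (s - \sum_(i < N) c s i * x ^+ i).
Proof. by rewrite maxideal_pow_fil; exact: fil_trunc. Qed.

Lemma maxideal_pow_monomial l b i :
  maxideal_pow B (l - i) b -> maxideal_pow S l (b * x ^+ i).
Proof. by rewrite maxideal_pow_fil; exact: fil_mon. Qed.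

End SkewExtension.

(** * Exponents and well-orders *)

Section Exponents.
Variable n : nat.
Implicit Types alpha beta : expo n.

Definition deg alpha : nat := (\sum_i alpha i)%N.

(** The exponents of the monomials available at stage [m] of the tower. *)
Definition supported (m : nat) alpha : Prop :=
  forall i : 'I_n, (m <= i)%N -> alpha i = 0%N.

Definition set_expo alpha (m : 'I_n) (j : nat) : expo n :=
  [ffun i => if i == m then j else alpha i].

Lemma expo0 i : (0 : expo n) i = 0%N. Proof. by rewrite ffunE. Qed.

Lemma expoD alpha beta i : (alpha + beta) i = (alpha i + beta i)%N.
Proof. by rewrite ffunE. Qed.

Lemma degD alpha beta : deg (alpha + beta) = (deg alpha + deg beta)%N.
Proof. by rewrite -big_split; apply: eq_bigr => i _; rewrite expoD. Qed.

Lemma deg0 : deg 0 = 0%N.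
Proof. by rewrite /deg big1 // => i _; rewrite expo0. Qed.

Lemma supported_full alpha : supported n alpha.
Proof. by move=> i; rewrite leqNgt ltn_ord. Qed.

Lemma supported0 alpha : supported 0 alpha -> alpha = 0.
Proof. by move=> a0; apply/ffunP => i; rewrite expo0 a0. Qed.

Lemma set_expo_id alpha m j : alpha m = j -> set_expo alpha m j = alpha.
Proof. by move=> <-; apply/ffunP => i; rewrite ffunE; case: eqP => [->|]. Qed.

Lemma set_expo_set alpha m i j :
  set_expo (set_expo alpha m i) m j = set_expo alpha m j.
Proof. by apply/ffunP => k; rewrite !ffunE; case: eqP. Qed.

Lemma set_expo_supported alpha (m : 'I_n) j :
  supported m alpha -> supported m.+1 (set_expo alpha m j).
Proof.
move=> am i mi; rewrite ffunE; case: eqP mi => [->|_ mi]; first by rewrite ltnn.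
by rewrite am // ltnW.
Qed.

Lemma set_expo0_supported alpha (m : 'I_n) :
  supported m.+1 alpha -> supported m (set_expo alpha m 0).
Proof.
move=> am i mi; rewrite ffunE; case: eqP => // im; apply: am.
rewrite ltn_neqAle mi andbT; apply/eqP => e; by case: im; apply: val_inj.
Qed.

Lemma deg_set_expo0 alpha m :
  (deg (set_expo alpha m 0) + alpha m)%N = deg alpha.
Proof.
rewrite /deg (bigD1 m) //= [in RHS](bigD1 m) //= ffunE eqxx add0n addnC.
by congr (_ + _)%N; apply: eq_bigr => i /negPf im; rewrite ffunE im.
Qed.

End Exponents.

(** * Dickson's lemma, and additive total orders as well-orders *)

Section Dickson.
Variable n : nat.

(** [m N] is an index at which [u] is minimal among all indices from [N] on; [phi] repeats this
    choice just after its previous value. *)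
Lemma nondecreasing_subsequence (u : nat -> nat) :
  exists phi : nat -> nat, (forall i, phi i < phi i.+1)%N /\
    (forall i j, i <= j -> u (phi i) <= u (phi j))%N.
Proof.
have minP N : exists i, (N <= i)%N /\ forall j, (N <= j)%N -> (u i <= u j)%N.
  pose P b := `[< exists2 i, (N <= i)%N & u i = b >].
  have exP : exists b, P b by exists (u N); apply/asboolP; exists N.
  case: (ex_minnP exP) => b /asboolP[i Ni uib] bmin.
  exists i; split=> // j Nj; rewrite uib; apply: bmin; apply/asboolP.
  by exists j.
have [m mP] := choice minP.
pose phi := fix phi i := if i is i'.+1 then m (phi i').+1 else m 0%N.
have phiS i : (phi i < phi i.+1)%N by case: (mP (phi i).+1).
exists phi; split=> // i j /subnKC <-.
have phi_le l : (phi i <= phi (i + l))%N.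
  elim: l => [|l IHl]; first by rewrite addn0.
  by rewrite addnS; exact: leq_trans IHl (ltnW _).
case: i phi_le => [|i] phi_le; first by case: (mP 0%N) => _; apply.
case: (mP (phi i).+1) => _; apply; exact: leq_trans (phiS i) (phi_le _).
Qed.

(** Passing to a nondecreasing subsequence for one coordinate after the other makes all of them
    nondecreasing. *)
Lemma dickson (u : nat -> expo n) :
  exists i j, (i < j)%N /\ forall s, (u i s <= u j s)%N.
Proof.
have : forall m, (m <= n)%N -> exists phi : nat -> nat,
    (forall i, phi i < phi i.+1)%N /\
    (forall s : 'I_n, (s < m)%N ->
       forall i j, i <= j -> u (phi i) s <= u (phi j) s)%N; last first.
  move=> /(_ n (leqnn n))[phi [phiS up]].
  by exists (phi 0%N), (phi 1%N); split=> // s; apply: up.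
elim=> [|m IHm] mn; first by exists id.
have [phi [phiS up]] := IHm (ltnW mn).
have [psi [psiS um]] :=
  nondecreasing_subsequence (fun i => u (phi i) (Ordinal mn)).
have mono (f : nat -> nat) : (forall i, f i < f i.+1)%N ->
    forall i j, (i <= j)%N -> (f i <= f j)%N.
  move=> fS i j /subnKC <-; elim: (j - i)%N => [|l IHl];
    rewrite ?addn0 // addnS.
  exact: leq_trans IHl (ltnW _).
exists (phi \o psi); split=> [i|s] /=.
  by apply: leq_trans (phiS _) _; apply: mono.
rewrite ltnS leq_eqVlt => /orP[/eqP sm|sm] i j ij; last exact/up/mono.
have -> : s = Ordinal mn by exact: val_inj.
exact: um.
Qed.

Variable le : rel (expo n).
Hypothesis le_order : additive_total_order le.

Lemma ato_refl alpha : le alpha alpha.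
Proof. by case: le_order => /(_ alpha alpha); rewrite orbb. Qed.

Lemma ato_trans beta alpha gamma : le alpha beta -> le beta gamma ->
  le alpha gamma.
Proof. by case: le_order => _ _ tr _ _; exact: tr. Qed.

Lemma ato_anti alpha beta : le alpha beta -> le beta alpha -> alpha = beta.
Proof. by case: le_order => _ anti _ _ _ ab ba; apply: anti; rewrite ab. Qed.

Lemma ato_ltNge alpha beta : strict le alpha beta = ~~ le beta alpha.
Proof.
rewrite /strict; case: le_order => tot _ _ _ _.
have := tot alpha beta; case ba: (le beta alpha) => /=; last first.
  rewrite orbF => ->; rewrite andbT; apply: contraFneq ba => ->;
    exact: ato_refl.
by case: eqP => //= nab _; apply/negP => ab; apply: nab; exact: ato_anti.
Qed.

Lemma ato_ltW alpha beta : strict le alpha beta -> le alpha beta.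
Proof. by case/andP. Qed.

Lemma ato_le_lt beta alpha gamma :
  le alpha beta -> strict le beta gamma -> strict le alpha gamma.
Proof.
move=> ab; rewrite !ato_ltNge; apply: contra => ga; exact: ato_trans ga ab.
Qed.

Lemma ato_lt_le beta alpha gamma :
  strict le alpha beta -> le beta gamma -> strict le alpha gamma.
Proof.
move=> + bg; rewrite !ato_ltNge; apply: contra => ga; exact: ato_trans bg ga.
Qed.

Lemma ato_leD2r gamma alpha beta : le alpha beta ->
  le (alpha + gamma) (beta + gamma).
Proof.
have [<- _|ab le_ab] := eqVneq alpha beta; first exact: ato_refl.
by case: le_order => _ _ _ _ add; apply/ato_ltW/add; rewrite /strict ab.
Qed.

Lemma ato_ltD2r gamma alpha beta :
  strict le alpha beta -> strict le (alpha + gamma) (beta + gamma).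
Proof. by case: le_order => _ _ _ _; apply. Qed.

Lemma ato_le0 alpha : le 0 alpha.
Proof.
have [->|a0] := eqVneq alpha 0; first exact: ato_refl.
by case: le_order => _ _ _ pos _; exact/ato_ltW/pos.
Qed.

Lemma ato_leDl alpha beta : le alpha (beta + alpha).
Proof. by have := ato_leD2r alpha (ato_le0 beta); rewrite add0r. Qed.

Lemma ato_well_founded : well_founded (strict le).
Proof.
move=> alpha; apply: contrapT => nacc.
pose X := {alpha | ~ Acc (strict le) alpha}.
have next (a : X) : {b : X | strict le (sval b) (sval a)}.
  apply: cid; case: a => a na /=; apply: contrapT => nob; apply: na.
  constructor=> b ba; apply: contrapT => nb; apply: nob.
  by exists (exist _ b nb).
have [u [_ us]] := dependent_choice next (exist _ alpha nacc).
have lt_u i j : (i < j)%N -> strict le (sval (u j)) (sval (u i)).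
  elim: j => // j IHj; rewrite ltnS leq_eqVlt => /orP[/eqP->|/IHj ji];
    first exact: us.
  exact: ato_le_lt (ato_ltW (us j)) ji.
have [i [j [/lt_u ij le_ij]]] := dickson (fun i => sval (u i)).
move: ij; rewrite ato_ltNge => /negP; apply.
(* Dickson's lemma writes [u j] as an exponent plus [u i], so [u i] is at most [u j], against the
   strict descent. *)
have -> : sval (u j) = [ffun s => sval (u j) s - sval (u i) s]%N + sval (u i).
  by apply/ffunP => s; rewrite !ffunE; exact/esym/subnK.
exact: ato_leDl.
Qed.

Lemma ato_min (X : set (expo n)) : (exists alpha, X alpha) ->
  exists2 alpha, X alpha & forall beta, X beta -> le alpha beta.
Proof.
move=> [alpha]; elim/(well_founded_ind ato_well_founded): alpha => alpha IH Xa.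
have [[beta [Xb ba]]|min] := pselect (exists beta,
  X beta /\ strict le beta alpha).
  exact: IH ba Xb.
exists alpha => // beta Xb; apply: contrapT => /negP; rewrite -ato_ltNge => ba.
by apply: min; exists beta.
Qed.

(** Well-founded recursion in a form free of dependent types: [G] receives a total function, with
    the filler [k0] at every exponent not strictly below [beta]. *)
Lemma ato_rec (K : Type) (k0 : K) (G : expo n -> (expo n -> K) -> K) :
  exists d : expo n -> K, forall beta,
    d beta = G beta (fun gamma => if strict le gamma beta then d gamma else k0).
Proof.
pose F beta (rec : forall gamma, strict le gamma beta -> K) :=
  G beta (fun gamma => if pselect (strict le gamma beta) is left h
                       then rec gamma h else k0).
exists (Fix ato_well_founded (fun=> K) F) => beta.
rewrite [LHS]Fix_eq /F => [|alpha f g fg].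
  congr G; apply: funext => gamma; case: pselect => [->//|/negP/negPf->//].
congr G; apply: funext => gamma; by case: pselect.
Qed.

End Dickson.

(** * Monomials in the tower *)

(** In an ordered product of noncommuting factors, [G m] comes last because every later factor is
    [1]. *)
Lemma prod_ord_last (R : nzRingType) n (F G : 'I_n -> R) (m : 'I_n) :
  (forall i : 'I_n, (i < m)%N -> F i = G i) ->
  (forall i : 'I_n, (m < i)%N -> G i = 1) ->
  (forall i : 'I_n, (m <= i)%N -> F i = 1) ->
  \prod_i G i = (\prod_i F i) * G m.
Proof.
elim: n F G m => [|n IHn] F G m FG G1 F1; first by case: (m).
rewrite big_ord_recr [in RHS]big_ord_recr /=.
have -> : F ord_max = 1 by apply: F1; exact: leq_ord.
rewrite mulr1.
have [mn|mn] := ltnP m n; last first.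
  have -> : m = ord_max by apply: val_inj; apply: anti_leq;
    rewrite -ltnS ltn_ord.
  by congr (_ * _); apply: eq_bigr => i _; rewrite FG //=; exact: leq_trans mn.
rewrite [G ord_max]G1 // mulr1.
have em : m = widen_ord (leqnSn n) (Ordinal mn) by apply: val_inj.
rewrite [in G m]em; apply: (IHn _ (fun i => G (widen_ord _ i))) => i mi.
- exact: FG.
- exact: G1.
- exact: F1.
Qed.

Lemma xmon_set_expo (R : unitRingType) n (x : 'I_n -> R) alpha (m : 'I_n) j :
  supported m alpha -> xmon x (set_expo alpha m j) = xmon x alpha * x m ^+ j.
Proof.
move=> am; rewrite /xmon.
rewrite (@prod_ord_last _ _ (fun i => x i ^+ alpha i) _ m).
- by rewrite ffunE eqxx.
- by move=> i im; rewrite ffunE; case: eqP im => // ->; rewrite ltnn.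
- move=> i mi; rewrite ffunE; case: eqP mi => [->|_ mi]; first by rewrite ltnn.
  by rewrite am ?expr0 // ltnW.
- by move=> i mi; rewrite am ?expr0.
Qed.

Lemma xmon0 (R : unitRingType) n (x : 'I_n -> R) : xmon x 0 = 1.
Proof. by rewrite /xmon big1 // => i _; rewrite expo0 expr0. Qed.

Section Tower.
Variables (k : finFieldType) (A : idomainType) (R : unitRingType).
Variables (emb : {rmorphism A -> R}) (res : {rmorphism A -> k}).
Variables (n : nat) (x : 'I_n -> R).
Implicit Types (m l : nat) (B S : set R).

Local Notation term u := (emb u.1 * xmon x u.2).

(** Coefficients are arbitrary elements of [A] and exponents may repeat, so that adding two such
    sums is concatenation; the reduction to digits comes later. *)
Definition spanned B (T : set (expo n)) l (r : R) : Prop :=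
  exists2 s : seq (A * expo n), {in s, forall u, T u.2} &
    maxideal_pow B l (r - \sum_(u <- s) term u).

Definition independent B m : Prop :=
  forall j (s : seq (expo n)) (a : expo n -> A), uniq s ->
    {in s, forall alpha, supported m alpha /\ deg alpha = j} ->
    maxideal_pow B j.+1 (\sum_(alpha <- s) emb (a alpha) * xmon x alpha) ->
    {in s, forall alpha, res (a alpha) = 0}.

(* The classes of the monomials of degree j in the first m variables form a
   basis of m_B^j / m_B^(j+1) over the residue field. *)
Definition monomial_basis B m : Prop :=
  [/\ complete_local_ring B, range emb `<=` B,
      (forall i : 'I_n, (i < m)%N -> maxideal B (x i)),
      (forall r, B r -> forall l, spanned B (@supported n m) l r) &
      independent B m].

Lemma spannedD B T l r s : local_ring B ->
  spanned B T l r -> spanned B T l s -> spanned B T l (r + s).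
Proof.
move=> locB [u uT ru] [v vT sv]; exists (u ++ v).
  by move=> w; rewrite mem_cat => /orP[/uT|/vT].
rewrite big_cat /= opprD addrACA; apply: asubD => //; exact: maxideal_pow_asub.
Qed.

Lemma spanned_congr B T l r s : local_ring B ->
  maxideal_pow B l (r - s) -> spanned B T l s -> spanned B T l r.
Proof.
move=> locB rs [u uT su]; exists u => //.
exact: (asub_trans (maxideal_pow_asub locB l) rs).
Qed.

Lemma xmon_mem B m alpha : local_ring B ->
  (forall i : 'I_n, (i < m)%N -> maxideal B (x i)) ->
  supported m alpha -> B (xmon x alpha).
Proof.
move=> [sB _] mx am; apply: subring_prod => // i _.
have [im|mi] := ltnP i m; first by apply: subring_exp => //; case: (mx i im).
by rewrite am // expr0; exact: subring_one.
Qed.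

(** A monomial in the variables up to [x m] is one in the earlier variables times a power of [x m],
    so both spanning and independence reduce to the coefficients in [B] of the powers of [x m]. *)
Lemma monomial_basis_extension B S (m : 'I_n) sigma delta :
  skew_power_series_ring B S (x m) sigma delta ->
  monomial_basis B m -> monomial_basis S m.+1.
Proof.
move=> [[complB locd] [sS BS Sx] xE [c psc contS]] [_ embB mx dense indep].
have [complS powS] := skew_extension_complete complB locd sS BS Sx xE psc contS.
have powmon := maxideal_pow_monomial complB locd sS BS Sx xE psc contS.
have powtrunc := series_coef_truncation complB locd sS BS Sx xE psc contS.
have locB : local_ring B by case: complB.
have locS : local_ring S by case: complS.
have sB : subring_closed (mem B) by case: locB.
have monB alpha : supported m alpha -> B (xmon x alpha) by exact: xmon_mem.
split=> //.
- by move=> r /embB /BS.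
- move=> i; rewrite ltnS leq_eqVlt => /orP[/eqP/val_inj->|im].
    rewrite -maxideal_pow1 // -[x m]mul1r -[x m]expr1; apply: powmon.
    exact: subring_one.
  rewrite -maxideal_pow1 // -[x i]mulr1 -(expr0 (x m)); apply: powmon.
  by rewrite subn0 maxideal_pow1 //; exact: mx.
- move=> r Sr l.
  (* Truncate at [l] terms, then approximate each coefficient in [B]. *)
  apply: spanned_congr => //; first exact: powtrunc.
  apply: big_ind => [||i _]; last 1 first.
  - have [s sm rs] := dense _ (series_coef_mem psc i Sr) l.
    exists [seq (u.1, set_expo u.2 m i) | u <- s].
      by move=> _ /mapP[u us ->] /=; apply: set_expo_supported; exact: sm.
    rewrite big_map /= big_seq.
    under eq_bigr => u us do rewrite (xmon_set_expo _ _ (sm u us)) mulrA.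
    rewrite -big_seq -mulr_suml -mulrBl; apply: powmon.
    exact: (maxideal_pow_le locB (leq_subr i l)).
  - exists [::] => //; rewrite big_nil subrr; apply: asub0.
    exact: maxideal_pow_asub.
  - by move=> u v; exact: spannedD.
- move=> j s a us sj ms alpha alphas.
  (* The coefficient of [x m ^+ i] in the sum is a combination of monomials of degree [j - i] in the
     earlier variables, and it lies in the power [j.+1 - i = (j - i).+1]; independence over [B]
     therefore applies to it. *)
  pose i := alpha m.
  have ij : (i <= j)%N.
    by have [_ <-] := sj _ alphas; rewrite -(deg_set_expo0 alpha m) leq_addl.
  (* The exponents of [s] with entry [i] at [m], that entry being erased; [set_expo _ m i] restores
     it. *)
  pose s' := [seq set_expo beta m 0 |
               beta <- [seq beta : expo n <- s | beta m == i]].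
  have us' : uniq s'.
    rewrite map_inj_in_uniq ?filter_uniq // => b b'; rewrite !mem_filter.
    move=> /andP[/eqP bi _] /andP[/eqP bi' _] bb'.
    by rewrite -(set_expo_id bi) -(set_expo_set _ _ 0) bb' set_expo_set set_expo_id.
  have sj' : {in s', forall beta, supported m beta /\ deg beta = (j - i)%N}.
    move=> _ /mapP[b + ->]; rewrite mem_filter => /andP[/eqP bi bs].
    have [bm <-] := sj _ bs; split; first exact: set_expo0_supported.
    by rewrite -(deg_set_expo0 b m) bi addnK.
  have termE b : b \in s -> emb (a b) * xmon x b =
      emb (a b) * xmon x (set_expo b m 0) * x m ^+ b m.
    move=> /sj[bm _]; rewrite -mulrA -xmon_set_expo.
      by rewrite set_expo_set set_expo_id.
    exact: set_expo0_supported.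
  have Bterm b : b \in s -> B (emb (a b) * xmon x (set_expo b m 0)).
    move=> /sj[bm _]; apply: subring_mul => //; first by apply/embB;
      exists (a b).
    by apply: monB; exact: set_expo0_supported.
  have := indep _ s' (fun b => a (set_expo b m i)) us' sj'.
  have -> : \sum_(b <- s') emb (a (set_expo b m i)) * xmon x b =
      c (\sum_(b <- s) emb (a b) * xmon x b) i.
    rewrite [in RHS]big_seq (series_coef_sum sS psc) => [|b bs]; last first.
      by rewrite termE //; apply: subring_mul (subring_exp _ _ _); auto.
    rewrite -big_seq big_map big_filter big_mkcond /=.
    apply: eq_big_seq => b bs; rewrite termE //.
    rewrite (series_coef_monomial sS Sx psc); last exact: Bterm.
    rewrite set_expo_set eq_sym; case: eqP => [e|_]; last by rewrite mulr0.
    by rewrite set_expo_id // mulr1.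
  move/powS: ms => [_ /(_ i)]; rewrite subSn // => msi.
  move=> /(_ msi (set_expo alpha m 0)).
  rewrite set_expo_set (set_expo_id (erefl (alpha m))); apply.
  by apply/mapP; exists alpha => //; rewrite mem_filter eqxx.
Qed.
End Tower.

(** * The coefficient ring and its copy in the ambient ring *)

Section Base.
Variables (A : idomainType) (R : unitRingType) (emb : {rmorphism A -> R}).
Hypothesis emb_inj : injective emb.
Hypothesis complA : complete_local_ring [set: A].

Let locA : local_ring [set: A]. Proof. by case: complA. Qed.

Lemma subring_range : subring_closed (mem (range emb)).
Proof.
split; first by rewrite inE; exists 1; rewrite ?rmorph1.
  move=> c d; rewrite !inE => -[a _ <-] [b _ <-].
  by exists (a - b); rewrite ?rmorphB.
move=> c d; rewrite !inE => -[a _ <-] [b _ <-].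
by exists (a * b); rewrite ?rmorphM.
Qed.

Lemma unit_in_range a : unit_in (range emb) (emb a) <-> unit_in [set: A] a.
Proof.
split=> [[_ [_ [[b _ <-]]]]|[_ [b [_ ab ba]]]].
  rewrite -!rmorphM -(rmorph1 emb) => /emb_inj ab /emb_inj ba.
  by split=> //; exists b.
split; first by exists a.
by exists (emb b); rewrite -!rmorphM ab ba rmorph1; split=> //; exists b.
Qed.

Lemma maxideal_range : maxideal (range emb) = emb @` maxideal [set: A].
Proof.
apply/seteqP; split=> [_ [[a _ <-] na]|_ [a [_ na] <-]].
  by exists a => //; split=> // ua; apply/na/unit_in_range.
by split=> [|/unit_in_range//]; exists a.
Qed.

Lemma maxideal_pow_range l :
  maxideal_pow (range emb) l = emb @` maxideal_pow [set: A] l.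
Proof.
elim: l => [//|l IHl] /=; rewrite IHl maxideal_range.
apply/seteqP; split=> [|_ [_ [i [a [b [ab ->]]]] <-]].
  apply: ideal_prod_sub => [|_ _ [a ma <-] [b mb <-]].
    have addm := maxideal_pow_asub locA l.+1.
    split=> [|_ _ [a ma <-] [b mb <-]].
      by exists 0; rewrite ?rmorph0 //; exact: asub0 addm.
    by exists (a - b); rewrite ?rmorphB //; exact: (asubB addm).
  by exists (a * b); rewrite ?rmorphM //; exact: ideal_prod_mul.
exists i, (emb \o a), (emb \o b); split=> [j|].
  by have [ma mb] := ab j; split; [exists (a j)|exists (b j)].
by rewrite rmorph_sum; apply: eq_bigr => j _; rewrite rmorphM.
Qed.

Lemma maxideal_pow_emb l a :
  maxideal_pow (range emb) l (emb a) <-> maxideal_pow [set: A] l a.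
Proof.
by rewrite maxideal_pow_range; split=> [[b mb /emb_inj<-]//|ma]; exists a.
Qed.

Lemma complete_local_ring_range : complete_local_ring (range emb).
Proof.
case: complA => [[_ [_ m0 mB ml mr]] sep compl]; split.
- split; first exact: subring_range.
  rewrite maxideal_range; split.
  + by move=> _ [a _ <-]; exists a.
  + by exists 0; rewrite ?rmorph0.
  + move=> _ _ [a ma <-] [b mb <-]; exists (a - b); rewrite ?rmorphB //.
    exact: mB.
  + move=> _ _ [b _ <-] [a ma <-]; exists (b * a); rewrite ?rmorphM //.
    exact: ml.
  + move=> _ _ [b _ <-] [a ma <-]; exists (a * b); rewrite ?rmorphM //.
    exact: mr.
- move=> b mb; have [a _ ab] := mb 0%N; rewrite -ab [a]sep ?rmorph0 // => l.
  by apply/maxideal_pow_emb; rewrite ab.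
- move=> s Bs cau.
  have /choice[t ts] : forall i, exists a, s i = emb a.
    by move=> i; have [a _ <-] := Bs i; exists a.
  have [//|l|b _ lb] := compl t.
    have [N Nl] := cau l; exists N => i j Ni Nj; apply/maxideal_pow_emb.
    by rewrite rmorphB -!ts; exact: Nl.
  exists (emb b) => [|l]; first by exists b.
  have [N Nl] := lb l; exists N => i Ni.
  by rewrite ts -rmorphB; apply/maxideal_pow_emb; exact: Nl.
Qed.

End Base.

(** * Monomial bases for towers of types (A) and (B) *)

Section Towers.
Variables (k : finFieldType) (A : idomainType) (R : unitRingType).
Variables (emb : {rmorphism A -> R}) (res : {rmorphism A -> k}).
Variables (n : nat) (x : 'I_n -> R).

(** The bottom of the tower: each degree has at most one monomial, so independence concerns a single
    term. *)
Lemma monomial_basis_range m :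
  injective emb -> complete_local_ring [set: A] ->
  (forall i : 'I_n, (i < m)%N -> maxideal (range emb) (x i)) ->
  (forall alpha beta : expo n, supported m alpha -> supported m beta ->
     deg alpha = deg beta -> alpha = beta) ->
  (forall (alpha : expo n) a, supported m alpha ->
     maxideal_pow (range emb) (deg alpha).+1 (emb a * xmon x alpha) ->
     res a = 0) ->
  monomial_basis emb res x (range emb) m.
Proof.
move=> emb_inj complA mx deg_inj res0.
have complE := complete_local_ring_range emb_inj complA.
split=> // [_ [a _ <-] l|j s a us sj ms alpha alphas].
  exists [:: (a, 0)] => [u|]; first by rewrite inE => /eqP-> i _; rewrite expo0.
  rewrite big_seq1 /= xmon0 mulr1 subrr; apply: asub0.
  by apply: maxideal_pow_asub; case: complE.
have [sa da] := sj _ alphas; apply: (res0 alpha) => //; rewrite da.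
suff es : s = [:: alpha] by rewrite es big_seq1 in ms.
have eqs b : b \in s -> b = alpha.
  by move=> /sj[sb db]; apply: deg_inj => //; rewrite db.
case: s us sj ms alphas eqs => [|b [|b' s]] //= us _ _ _ eqs.
  by rewrite (eqs b) ?inE.
by move: us; rewrite (eqs b) ?inE ?eqxx // (eqs b') ?inE ?eqxx ?orbT.
Qed.

Lemma tower_monomial_basis d (R_ : nat -> set R) (sigma delta : nat -> R -> R) :
  (d <= n)%N ->
  (forall i : 'I_n, (d <= i)%N ->
     skew_power_series_ring (R_ i) (R_ i.+1) (x i) (sigma i) (delta i)) ->
  monomial_basis emb res x (R_ d) d ->
  forall m, (d <= m <= n)%N -> monomial_basis emb res x (R_ m) m.
Proof.
move=> dn ext basis m /andP[/subnKC <-]; elim: (m - d)%N => [|i IHi].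
  by rewrite addn0.
rewrite addnS => din.
apply: (monomial_basis_extension (ext (Ordinal din) (leq_addr _ _))).
exact: IHi (ltnW din).
Qed.

(** On the image of [A], linearity reduces the relation [x r = sigma r x + delta r] to
    commutation. *)
Lemma tower_central d (R_ : nat -> set R) (sigma delta : nat -> R -> R) :
  (d <= n)%N ->
  (forall i : 'I_n, (d <= i)%N ->
     skew_power_series_ring (R_ i) (R_ i.+1) (x i) (sigma i) (delta i) /\
     linear_over (range emb) (sigma i) (delta i)) ->
  monomial_basis emb res x (R_ d) d ->
  forall (i : 'I_n) a, (d <= i)%N -> x i * emb a = emb a * x i.
Proof.
move=> dn ext basis i a di; have [skew lin] := ext i di.
have ext' j dj := proj1 (ext j dj).
have [|_ embR _ _ _] := tower_monomial_basis dn ext' basis (m := i).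
  by rewrite di ltnW.
have [|sa da] := lin (emb a); first by exists a.
have [_ _ xE _] := skew; rewrite xE ?sa ?da ?addr0 //.
by apply: embR; exists a.
Qed.

(* In type (B), [z] is the exponent of the uniformiser; in type (A), where there
   are no carries, its value does not matter. *)
Definition carries (z : expo n) : Prop := forall a, res a = 0 ->
  a = 0 \/ deg z = 1%N /\
    exists b, forall alpha, emb a * xmon x alpha = emb b * xmon x (alpha + z).

Lemma iterated_skew_power_series_basis d :
  (d <= n)%N -> iterated_skew_power_series (range emb) d x ->
  monomial_basis emb res x (range emb) d ->
  (forall (i : 'I_n) a, (i < d)%N -> x i * emb a = emb a * x i) ->
  monomial_basis emb res x [set: R] n /\
  forall i a, x i * emb a = emb a * x i.
Proof.
move=> dn [R_ [sigma [delta [Rd Rn ext]]]]; rewrite -Rd => basis comm.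
have ext' j dj := proj1 (ext j dj).
split; first by rewrite -Rn; apply: (tower_monomial_basis dn ext') => //;
  rewrite dn /=.
move=> i a; have [/comm//|di] := ltnP i d.
exact: (tower_central dn ext basis).
Qed.

(** Here [A] is isomorphic to [k], hence a field: its maximal ideal is [0], [emb] is injective, the
    only monomial at the bottom is [1], and nothing is ever carried. *)
Lemma type_A_basis : type_A emb res x ->
  [/\ monomial_basis emb res x [set: R] n,
      forall i a, x i * emb a = emb a * x i & carries 0].
Proof.
move=> [res_bij tower].
have res_inj := bij_inj res_bij.
have [g resK gK] := res_bij.
have unitA a : a != 0 -> unit_in [set: A] a.
  move=> a0; split=> //; exists (g (res a)^-1).
  have ra : res a != 0 by rewrite -(rmorph0 res) (inj_eq res_inj).
  have ab : a * g (res a)^-1 = 1 by apply: res_inj;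
    rewrite rmorphM gK rmorph1 divff.
  by split=> //; rewrite mulrC.
have m0 : maxideal [set: A] = [set 0].
  apply/seteqP; split=> [a [_ na] /=|_ ->].
    by apply/eqP; case: eqP => // /eqP/unitA.
  by split=> // -[_ [b [_ /eqP]]]; rewrite mul0r eq_sym oner_eq0.
have emb_inj : injective emb.
  move=> a b ab; apply/eqP; rewrite -subr_eq0; apply/eqP;
    apply: contrapT => /eqP/unitA.
  move=> [_ [c [_ /(congr1 emb)/eqP]]].
  by rewrite rmorphM rmorphB ab subrr mul0r rmorph1 eq_sym oner_eq0.
have powS l : maxideal_pow [set: A] l.+1 `<=` [set 0].
  rewrite /= m0; apply: ideal_prod_sub => [|a b -> _] /=; last by rewrite mul0r.
  by split=> // a b -> ->; rewrite subrr.
have complA : complete_local_ring [set: A].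
  split=> [|b /(_ 1%N)/powS//|s _ /(_ 1%N)[N Ns]].
    split; first by split=> [|a b _ _|a b _ _]; rewrite inE.
    rewrite m0; split=> // [a b -> ->|a b _ ->|a b _ ->].
    - by rewrite subrr.
    - by rewrite mulr0.
    - by rewrite mul0r.
  (* The first power of the maximal ideal is already [0], so the sequence is constant from [N]
     on. *)
  exists (s N) => // l; exists N => i Ni.
  have /powS/= -> := Ns i N Ni (leqnn N).
  elim: l => [//|l IHl] /=; exists 0%N, (fun=> 0), (fun=> 0).
  by split=> [[]//|]; rewrite big_ord0.
have [|||basis comm] := iterated_skew_power_series_basis _ tower.
- by [].
- apply: monomial_basis_range => //.
    by move=> alpha beta /supported0-> /supported0->.
  move=> alpha a /supported0 ->; rewrite deg0 xmon0 mulr1.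
  by move=> /(maxideal_pow_emb emb_inj complA)/powS/= ->; rewrite rmorph0.
- by [].
- split=> // a ra; left; apply: res_inj; by rewrite ra rmorph0.
Qed.

Lemma xmon_shift (i0 : 'I_n) alpha : i0 = 0%N :> nat ->
  xmon x (alpha + set_expo 0 i0 1) = x i0 * xmon x alpha.
Proof.
case: n x i0 alpha => [|n'] x' i0 alpha; first by case: i0.
move=> e; have -> : i0 = ord0 by apply: val_inj.
rewrite /xmon !big_ord_recl expoD ffunE eqxx addn1 exprS -mulrA.
by congr (_ * (_ * _)); apply: eq_bigr => i _;
  rewrite expoD ffunE /= expo0 addn0.
Qed.

Lemma deg_set_expo (i0 : 'I_n) j : deg (set_expo 0 i0 j) = j.
Proof.
rewrite -(deg_set_expo0 _ i0) set_expo_set ffunE eqxx.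
by rewrite set_expo_id ?expo0 // deg0.
Qed.

(** The monomials at the bottom are the powers of the uniformiser [u]. An element of residue [0] is
    a multiple [u * b], and since [x i0] is the first factor of every monomial, [u] is absorbed by
    raising the exponent by that of [x i0]. *)
Lemma type_B_basis : type_B emb res x -> exists z : expo n,
  [/\ monomial_basis emb res x [set: R] n,
      forall i a, x i * emb a = emb a * x i & carries z].
Proof.
move=> [[[complA _ [a0 a0n0 nua0]] _] emb_inj [_ res0] [i0 i00 [u uu xu]] tower].
exists (set_expo 0 i0 1).
(* [A] is not a field, so its maximal ideal is not [0]. *)
have u0 : u != 0.
  apply: contraNneq a0n0 => u0.
  have : maxideal [set: A] a0 by [].
  by rewrite uu u0 => -[b _ <-]; rewrite mul0r.
have powu l : maxideal_pow [set: A] l `<=` [set u ^+ l * b | b in [set: A]].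
  elim: l => [a _|l IHl] /=; first by exists a; rewrite // expr0 mul1r.
  apply: ideal_prod_sub => [|a b].
    split=> [|_ _ [a _ <-] [b _ <-]]; first by exists 0; rewrite ?mulr0.
    by exists (a - b); rewrite ?mulrBr.
  rewrite uu => -[a' _ <-] /IHl[b' _ <-]; exists (a' * b') => //.
  by rewrite exprS mulrACA.
have i0E (i : 'I_n) : (i < 1)%N -> i = i0.
  by rewrite ltnS leqn0 => /eqP i0'; apply: val_inj; rewrite /= i0' i00.
have suppE (alpha : expo n) : supported 1 alpha ->
  alpha = set_expo 0 i0 (deg alpha).
  move=> a1; have e : alpha = set_expo 0 i0 (alpha i0).
    apply/ffunP => i; rewrite ffunE; case: eqP => [->//|ii0].
    by rewrite expo0 a1 // lt0n; apply/eqP => i0'; apply: ii0; apply: i0E;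
      rewrite i0'.
  by rewrite {2}e deg_set_expo.
have mu : maxideal [set: A] u by rewrite uu; exists 1; rewrite ?mulr1.
have [|||basis comm] := iterated_skew_power_series_basis _ tower.
- by rewrite -i00 ltn_ord.
- apply: monomial_basis_range => //.
  + by move=> i /i0E->; rewrite maxideal_range // xu; exists u.
  + by move=> alpha beta /suppE-> /suppE->; rewrite !deg_set_expo => ->.
  (* With [d] the degree of [alpha], [u ^+ d * a] is a multiple of [u ^+ d.+1]; cancelling [u ^+ d]
     in the domain [A] puts [a] in the maximal ideal. *)
  + move=> alpha a /suppE e; have -> : xmon x alpha = emb (u ^+ deg alpha).
      rewrite {1}e xmon_set_expo; last by move=> i _; rewrite expo0.
      by rewrite xmon0 mul1r xu rmorphXn.
    rewrite -rmorphM => /(maxideal_pow_emb emb_inj complA)/powu[b _].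
    rewrite exprS mulrAC => /(mulIf (expf_neq0 (deg alpha) u0)) ab.
    by apply/res0; rewrite -ab uu; exists b.
- by move=> i a /i0E->; rewrite xu -!rmorphM mulrC.
- split=> // a /res0; rewrite uu => -[b _ <-]; right.
  rewrite deg_set_expo; split=> //; exists b => alpha.
  by rewrite xmon_shift // mulrC rmorphM -mulrA xu.
Qed.

End Towers.

(** * Expansions *)

Section Balls.
Variable n : nat.

(** Monomials of degree at least [l] vanish modulo the [l]-th power, so these exponents suffice at
    precision [l]. Degree below [l] bounds each entry by [l], whence the enumeration through finite
    functions. *)
Definition ball (l : nat) : seq (expo n) :=
  [seq alpha <- [seq [ffun i => g i : nat] | g : {ffun 'I_n -> 'I_l}]
     | deg alpha < l]%N.

Lemma mem_ball l (alpha : expo n) : (alpha \in ball l) = (deg alpha < l)%N.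
Proof.
rewrite mem_filter; case: ltnP => //= al.
have ai i : (alpha i < l)%N.
  apply: leq_ltn_trans al; rewrite /deg (bigD1 i) //=; exact: leq_addr.
apply/mapP; exists [ffun i => Ordinal (ai i)]; first by rewrite mem_enum.
by apply/ffunP => i; rewrite !ffunE.
Qed.

Lemma ball_uniq l : uniq (ball l).
Proof.
rewrite filter_uniq // map_inj_uniq ?enum_uniq // => g g' gg'.
by apply/ffunP => i; apply: val_inj; move/ffunP: gg' => /(_ i); rewrite !ffunE.
Qed.

End Balls.

Section Expansions.
Variables (k : finFieldType) (A : idomainType) (R : unitRingType).
Variables (emb : {rmorphism A -> R}) (res : {rmorphism A -> k}) (iota : k -> A).
Variables (n : nat) (x : 'I_n -> R) (z : expo n).
Hypothesis basis : monomial_basis emb res x [set: R] n.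
Hypothesis emb_central : forall i a, x i * emb a = emb a * x i.
Hypothesis carryz : carries emb res x z.
Hypothesis sec_iota : multiplicative_section res iota.
Implicit Types (alpha beta gamma : expo n) (c : expo n -> A) (T : set (expo n)).

Local Notation "''M^' l" := (maxideal_pow [set: R] l) (at level 8,
  l at level 2).
Local Notation mon := (xmon x).
Local Notation coef := (coef emb iota x).

Let complR : complete_local_ring [set: R]. Proof. by case: basis. Qed.
Let locR : local_ring [set: R]. Proof. by case: complR. Qed.
Let addM l : additive_subgroup 'M^l. Proof. exact: maxideal_pow_asub. Qed.

Lemma iotaK : cancel iota res. Proof. by case: sec_iota. Qed.
Lemma iotaM : {morph iota : a b / a * b}. Proof. by case: sec_iota. Qed.

(** The image of an idempotent is an idempotent of the domain [A]. This settles [iota 0] and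
    [iota 1], although [iota] need not be additive. *)
Lemma iota_eq0_or1 b : b * b = b -> iota b = 0 \/ iota b = 1.
Proof.
move=> bb; have /eqP := iotaM b b; rewrite bb -subr_eq0 -[X in X - _]mulr1.
rewrite -mulrBr mulf_eq0 => /orP[/eqP|]; first by left.
by rewrite subr_eq0 => /eqP <-; right.
Qed.

Lemma iota0 : iota 0 = 0.
Proof.
have [//|/(congr1 res)] := iota_eq0_or1 (mulr0 0).
by rewrite iotaK rmorph1 => /eqP; rewrite eq_sym oner_eq0.
Qed.

Lemma iota1 : iota 1 = 1.
Proof.
have [/(congr1 res)|//] := iota_eq0_or1 (mulr1 1).
by rewrite iotaK rmorph0 => /eqP; rewrite oner_eq0.
Qed.

Lemma iota_res a : range iota a -> iota (res a) = a.
Proof. by move=> [b _ <-]; rewrite iotaK. Qed.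

Lemma res_eq0 a : range iota a -> (res a == 0) = (a == 0).
Proof.
move=> /iota_res ra; apply/eqP/eqP => [r0|->]; last exact: rmorph0.
by rewrite -ra r0 iota0.
Qed.

Lemma range_iota b : range iota (iota b). Proof. by exists b. Qed.

Lemma range_iota0 : range iota 0. Proof. by rewrite -iota0;
  exact: range_iota. Qed.

Lemma emb_mon_comm a alpha : mon alpha * emb a = emb a * mon alpha.
Proof.
rewrite /xmon; elim/big_rec: _ => [|i y _ IH]; first by rewrite mulr1 mul1r.
rewrite -mulrA IH !mulrA; congr (_ * _).
elim: (alpha i) => [|j IHj]; first by rewrite mulr1 mul1r.
by rewrite exprS -mulrA IHj mulrA emb_central mulrA.
Qed.

Lemma mon_maxideal_pow alpha : 'M^(deg alpha) (mon alpha).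
Proof.
rewrite /xmon /deg; apply: (big_rec2 (fun d r => 'M^d r)) => // i d r _ dr.
apply: maxideal_powD => //; apply: maxideal_powX => //.
by case: basis => _ _ + _ _; apply.
Qed.

Lemma term_maxideal_pow l a alpha : (l <= deg alpha)%N ->
  'M^l (emb a * mon alpha).
Proof.
move=> la; apply: maxideal_pow_mull => //.
exact: maxideal_pow_le la _ (mon_maxideal_pow alpha).
Qed.

Definition digits c : Prop := forall alpha, range iota (c alpha).

Definition ball_sum l c : R := \sum_(alpha <- ball n l) emb (c alpha) * mon alpha.

(** Convergence over all large finite families, as in [expansion], amounts to convergence along
    balls, because the terms outside [ball n l] lie in ['M^l]. *)
Definition expands (r : R) c : Prop :=
  digits c /\ forall l, 'M^l (r - ball_sum l c).

Lemma ball_sum_diff_sum l (s : seq (expo n)) c :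
  uniq s -> {subset ball n l <= s} ->
  'M^l (\sum_(alpha <- s) emb (c alpha) * mon alpha - ball_sum l c).
Proof.
move=> us sl; rewrite /ball_sum (bigID (mem (ball n l))) /= -big_filter.
have p : perm_eq [seq i <- s | i \in ball n l] (ball n l).
  apply: uniq_perm => [||i]; [exact: filter_uniq|exact: ball_uniq|].
  by rewrite mem_filter andbC; case: (boolP (i \in ball n l)) => [/sl->|];
    rewrite ?andbF.
rewrite (perm_big _ p) addrC addrK; apply: asub_sum => // alpha.
by rewrite mem_ball -leqNgt; exact: term_maxideal_pow.
Qed.

Lemma ball_sum_le l l' c : (l <= l')%N -> 'M^l (ball_sum l' c - ball_sum l c).
Proof.
move=> ll'; apply: ball_sum_diff_sum; first exact: ball_uniq.
by move=> i; rewrite !mem_ball => il; exact: leq_trans ll'.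
Qed.

Lemma expansionP r c : expansion emb iota x r c <-> expands r c.
Proof.
split=> -[dc rc]; split=> // l; last first.
  exists (ball n l) => s us sl.
  apply: (asub_trans (addM l) (rc l)); apply: asub_sym => //.
  exact: ball_sum_diff_sum.
have [s0 rs0] := rc l.
pose s := undup (s0 ++ ball n l).
apply: (asub_trans (addM l) (b := \sum_(alpha <- s) emb (c alpha) * mon alpha)).
  apply: rs0; first exact: undup_uniq.
  by move=> i is0; rewrite mem_undup mem_cat is0.
apply: ball_sum_diff_sum; first exact: undup_uniq.
by move=> i il; rewrite mem_undup mem_cat il orbT.
Qed.

(** Induction on the degree [j]: terms of lower degree cancel and those of higher degree lie in
    ['M^(j.+1)], so independence gives equal residues in degree [j], and a digit is determined by
    its residue. *)
Lemma ball_sum_inj l c c' : digits c -> digits c' ->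
  'M^l (ball_sum l c - ball_sum l c') ->
  forall alpha, (deg alpha < l)%N -> c alpha = c' alpha.
Proof.
move=> dc dc' ml; suff agree j alpha : deg alpha = j -> (j < l)%N ->
  c alpha = c' alpha.
  by move=> alpha; apply: (agree (deg alpha)).
elim/ltn_ind: j alpha => j IH alpha aj jl.
pose a beta := c beta - c' beta.
have : 'M^(j.+1) (\sum_(beta <- ball n l) emb (a beta) * mon beta).
  apply: (maxideal_pow_le locR jl); congr ('M^l _) : ml.
  rewrite -sumrB; apply: eq_bigr => beta _.
  by rewrite -mulrBl rmorphB.
rewrite (bigID (fun beta => deg beta == j)) /= => mj.
have [_ _ _ _ indep] := basis.
have resa : res (a alpha) = 0.
  apply: (indep j [seq beta <- ball n l | deg beta == j]).
  - by rewrite filter_uniq ?ball_uniq.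
  - move=> beta; rewrite mem_filter => /andP[/eqP-> _]; split=> //.
    exact: supported_full.
  - rewrite big_filter.
    rewrite -[X in 'M^_ X](addrK (\sum_(i <- ball n l | deg i != j)
      emb (a i) * mon i)).
    apply: asubB => //; apply: asub_sum => // beta bj.
    case: (ltngtP (deg beta) j) bj => // [bj _|jb _];
      last exact: term_maxideal_pow.
    rewrite /a (IH (deg beta)) ?subrr ?rmorph0 ?mul0r //; first exact: asub0.
    exact: ltn_trans jl.
  - by rewrite mem_filter aj eqxx mem_ball aj.
rewrite -(iota_res (dc alpha)) -(iota_res (dc' alpha)).
by congr iota; apply/eqP; rewrite -subr_eq0 -rmorphB resa.
Qed.

Lemma expands_unique r c c' : expands r c -> expands r c' -> c = c'.
Proof.
move=> [dc rc] [dc' rc']; apply: funext => alpha.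
apply: (@ball_sum_inj (deg alpha).+1) => //.
exact: asub_trans (asub_sym _ (rc _)) (rc' _).
Qed.

Lemma ball_sum_update l c beta b : (deg beta < l)%N ->
  ball_sum l (fun alpha => if alpha == beta then b else c alpha) =
  ball_sum l c + emb (b - c beta) * mon beta.
Proof.
move=> bl; have bB : beta \in ball n l by rewrite mem_ball.
rewrite /ball_sum (bigD1_seq beta) ?ball_uniq //= eqxx.
rewrite [in RHS](bigD1_seq beta) ?ball_uniq //= addrAC -mulrDl -rmorphD.
rewrite [c beta + _]addrC subrK; congr (_ + _).
by apply: eq_bigr => i /negPf ib; rewrite ib.
Qed.

(** Reducing coefficients to digits moves terms only by repeated addition of [z], so it does not
    leave such a set. *)
Definition carry_closed T : Prop := forall alpha, T alpha -> T (alpha + z).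

(** The new digit [b] at [beta] is the one with the residue of [e = c beta + a]. The rest [e - b]
    has residue [0], so it vanishes or is carried to [beta + z], one degree higher; after at most
    [d] carries the term is negligible modulo ['M^l]. *)
Lemma add_term l T c a beta : carry_closed T -> digits c ->
  (forall alpha, c alpha != 0 -> T alpha) -> T beta ->
  exists c', [/\ digits c', forall alpha, c' alpha != 0 -> T alpha &
    'M^l (ball_sum l c + emb a * mon beta - ball_sum l c')].
Proof.
move=> zT; have [d] : exists d, (l <= deg beta + d)%N by exists l;
  exact: leq_addl.
elim: d c a beta => [|d IHd] c a beta ld dc cT Tb;
  (have [lb|bl] := leqP l (deg beta);
    first by exists c; split=> //; rewrite addrAC subrr add0r;
             exact: term_maxideal_pow).
  by move: ld; rewrite addn0 leqNgt bl.
pose e := c beta + a; pose b := iota (res e).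
pose c1 alpha := if alpha == beta then b else c alpha.
have dc1 : digits c1.
  by move=> alpha; rewrite /c1; case: eqP => // _; exact: range_iota.
have c1T alpha : c1 alpha != 0 -> T alpha.
  by rewrite /c1; case: (eqVneq alpha beta) => [->|_ /cT].
have e1 : ball_sum l c + emb a * mon beta =
          ball_sum l c1 + emb (e - b) * mon beta.
  rewrite ball_sum_update // -addrA -mulrDl -rmorphD; congr (_ + emb _ * _).
  by rewrite addrC addrA subrK /e addrAC subrr add0r.
have [|e0|[z1 [b' b'E]]] := carryz (a := e - b).
- by rewrite rmorphB iotaK subrr.
- exists c1; split=> //; rewrite e1 e0 rmorph0 mul0r addr0 subrr; exact: asub0.
have [||c' [dc' c'T c'l]] := IHd c1 b' (beta + z) _ dc1 c1T.
- by rewrite degD z1 addn1 addSnnS.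
- exact: zT.
by exists c'; split=> //; rewrite e1 b'E.
Qed.

(** The closure of the [A]-span of the monomials with exponent in [T]. It is visibly stable under
    sums, which a condition on digits is not; [closed_spanP] identifies the two for [T] closed under
    carries. *)
Definition closed_span T (r : R) : Prop := forall l,
  spanned emb x [set: R] T l r.

Lemma spanned_digits l T r : carry_closed T -> spanned emb x [set: R] T l r ->
  exists c, [/\ digits c, forall alpha, c alpha != 0 -> T alpha &
    'M^l (r - ball_sum l c)].
Proof.
move=> zT [s sT rs].
suff [c [dc cT cl]] : exists c, [/\ digits c, forall alpha, c alpha != 0 ->
  T alpha &
    'M^l (\sum_(u <- s) emb u.1 * mon u.2 - ball_sum l c)].
  by exists c; split=> //; exact: asub_trans rs cl.
elim: s sT {rs} => [|u s IHs] sT.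
  exists (fun=> 0); split=> [_|alpha|]; [exact: range_iota0| by rewrite eqxx |].
  rewrite big_nil /ball_sum big1 ?subrr; first exact: asub0.
  by move=> i _; rewrite rmorph0 mul0r.
have [|c [dc cT cl]] := IHs; first by move=> v vs; apply: sT;
  rewrite inE vs orbT.
have [|c' [dc' c'T c'l]] := @add_term l T c u.1 u.2 zT dc cT.
  by apply: sT; rewrite inE eqxx.
exists c'; split=> //; rewrite big_cons; apply: (asub_trans (addM l)) c'l.
by rewrite [ball_sum l c + _]addrC opprD addrACA subrr add0r.
Qed.

Lemma closed_span_expands T r : carry_closed T -> closed_span T r ->
  exists2 c, expands r c & forall alpha, c alpha != 0 -> T alpha.
Proof.
move=> zT Tr.
have [c cP] := choice (fun l => spanned_digits zT (Tr l)).
(* The digit at [alpha] is settled as soon as the precision exceeds [deg alpha]; finer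
   approximations agree with it by [ball_sum_inj]. *)
pose c' alpha := c (deg alpha).+1 alpha.
exists c'; last by move=> alpha; case: (cP (deg alpha).+1) => _ + _; apply.
split=> [alpha|l]; first by have [dc _ _] := cP (deg alpha).+1; exact: dc.
have -> : ball_sum l c' = ball_sum l (c l).
  apply: eq_big_seq => alpha; rewrite mem_ball => al; congr (emb _ * _).
  have [dc _ rc] := cP (deg alpha).+1; have [dc' _ rc'] := cP l.
  apply: (ball_sum_inj dc dc' _ (leqnn _)).
  apply: (asub_trans (addM _) (asub_sym (addM _) rc)).
  apply: (asub_trans (addM _) (maxideal_pow_le locR al rc')).
  exact: ball_sum_le.
by case: (cP l).
Qed.

Lemma coef_expands r : expands r (coef r).
Proof.
have [||c rc _] := @closed_span_expands setT r; first by [].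
  case: basis => _ _ _ dense _ l; have [s _ rs] := dense r I l.
  by exists s.
(* An expansion exists, so [xget] does not return its default. *)
apply/expansionP; rewrite /Defs.coef; case: xgetP => [_ _ //|/(_ c)].
by case; apply/expansionP.
Qed.

Lemma coef_unique r c : expands r c -> coef r = c.
Proof. exact: expands_unique (coef_expands r). Qed.

Lemma coef_digits r : digits (coef r).
Proof. by case: (coef_expands r). Qed.

Lemma iota_res_coef r alpha : iota (res (coef r alpha)) = coef r alpha.
Proof. exact/iota_res/coef_digits. Qed.

Lemma closed_spanP T r : carry_closed T ->
  closed_span T r <-> forall alpha, coef r alpha != 0 -> T alpha.
Proof.
move=> zT; split=> [/(closed_span_expands zT)[c rc cT]|cT l].
  by rewrite (coef_unique rc).
exists [seq (coef r alpha, alpha) | alpha <- ball n l & coef r alpha != 0].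
  by move=> _ /mapP[alpha + ->]; rewrite mem_filter => /andP[/cT].
case: (coef_expands r) => _ /(_ l); congr ('M^l (_ - _)).
rewrite big_map big_filter [RHS]big_mkcond; apply: eq_bigr => alpha _.
by case: eqP => //= ->; rewrite rmorph0 mul0r.
Qed.

Lemma digits_series c : digits c -> exists r, coef r = c.
Proof.
move=> dc; have [_ _ compl] := complR.
have [//|l|r _ lr] := compl (fun l => ball_sum l c).
  exists l => i j li lj; apply: (asub_trans (addM l) (ball_sum_le c li)).
  by apply: asub_sym => //; exact: ball_sum_le.
exists r; apply: coef_unique; split=> // l; have [N Nl] := lr l.
apply: (asub_trans (addM l) (asub_sym (addM l) (Nl _ (leq_maxl N l)))).
exact: ball_sum_le (leq_maxr _ _).
Qed.

(** With disjoint supports every sum of two digits is a digit, so no carry occurs. *)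
Lemma coef_disjoint r s :
  (forall alpha, coef r alpha = 0 \/ coef s alpha = 0) ->
  forall alpha, coef (r + s) alpha = coef r alpha + coef s alpha.
Proof.
move=> rs0 alpha; have [dr er] := coef_expands r;
  have [ds es] := coef_expands s.
rewrite (@coef_unique _ (fun alpha => coef r alpha + coef s alpha)) //.
split=> [beta|l].
  by case: (rs0 beta) => ->; rewrite ?add0r ?addr0.
have := asubD (addM l) (er l) (es l); congr ('M^l _).
rewrite addrACA -opprD; congr (_ - _); rewrite /ball_sum -big_split /=.
by apply: eq_bigr => beta _; rewrite -mulrDl -rmorphD.
Qed.

Lemma coef_split T r : exists r1 r2, [/\ r = r1 + r2,
  (forall alpha, coef r1 alpha = if `[< T alpha >] then coef r alpha else 0) &
  forall alpha, coef r2 alpha = if `[< T alpha >] then 0 else coef r alpha].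
Proof.
have [|r1 r1E] := @digits_series (fun alpha => if `[< T alpha >] then coef r alpha else 0).
  by move=> alpha; case: ifP => _; [exact: coef_digits|exact: range_iota0].
have [|r2 r2E] := @digits_series (fun alpha => if `[< T alpha >] then 0 else coef r alpha).
  by move=> alpha; case: ifP => _; [exact: range_iota0|exact: coef_digits].
exists r1, r2; split=> [|alpha|alpha]; rewrite ?r1E ?r2E //.
apply/eqP; rewrite -subr_eq0; apply/eqP; case: complR => _ + _; apply => l.
have [_ /(_ l) er] := coef_expands r; have [_ /(_ l) e1] := coef_expands r1.
have [_ /(_ l) e2] := coef_expands r2.
have := asubB (addM l) er (asubD (addM l) e1 e2); congr ('M^l _).
have -> : ball_sum l (coef r) = ball_sum l (coef r1) + ball_sum l (coef r2).
  rewrite /ball_sum -big_split /=; apply: eq_bigr => alpha _.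
  by rewrite r1E r2E -mulrDl -rmorphD; case: ifP; rewrite ?addr0 ?add0r.
by rewrite addrACA -opprD opprB addrA subrK.
Qed.

Lemma coef_term a gamma alpha : range iota a ->
  coef (emb a * mon gamma) alpha = if alpha == gamma then a else 0.
Proof.
move=> ia.
rewrite (@coef_unique _ (fun alpha => if alpha == gamma then a else 0)) //.
split=> [beta|l]; first by case: ifP => // _; exact: range_iota0.
have s0 : ball_sum l (fun=> 0) = 0.
  by rewrite /ball_sum big1 // => i _; rewrite rmorph0 mul0r.
have [lg|gl] := leqP l (deg gamma).
  have -> : ball_sum l (fun alpha => if alpha == gamma then a else 0) = 0.
    rewrite -[RHS]s0; apply: eq_big_seq => beta; rewrite mem_ball => bl.
    by case: eqP => // bg; move: bl; rewrite bg ltnNge lg.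
  by rewrite subr0; exact: term_maxideal_pow.
by rewrite ball_sum_update // s0 add0r subr0 subrr; exact: asub0.
Qed.

Lemma coef_scale b r alpha : coef (emb (iota b) * r) alpha = iota b * coef r alpha.
Proof.
have [dr er] := coef_expands r.
rewrite (@coef_unique _ (fun alpha => iota b * coef r alpha)) //.
split=> [beta|l].
  by rewrite -(iota_res (dr beta)) -iotaM; exact: range_iota.
have := maxideal_pow_mull locR (a := emb (iota b)) I (er l); congr ('M^l _).
rewrite mulrBr; congr (_ - _); rewrite mulr_sumr; apply: eq_bigr => beta _.
by rewrite mulrA -rmorphM.
Qed.

Lemma coef_eq0 r : (forall alpha, coef r alpha = 0) -> r = 0.
Proof.
move=> r0; case: complR => _ + _; apply => l.
have [_ /(_ l)] := coef_expands r; rewrite /ball_sum big1 ?subr0 // => i _.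
by rewrite r0 rmorph0 mul0r.
Qed.

Lemma coef_zero alpha : coef 0 alpha = 0.
Proof.
rewrite (@coef_unique _ (fun=> 0)) //; split=> [beta|l];
  first exact: range_iota0.
rewrite /ball_sum big1 ?subrr; first exact: asub0.
by move=> i _; rewrite rmorph0 mul0r.
Qed.

(** Modulo the maximal ideal [r] is [emb (coef r 0)], and a nonzero digit [iota b] has inverse
    [iota b^-1]. *)
Lemma unit_coef0 r : (r \is a GRing.unit) = (coef r 0 != 0).
Proof.
have unitE s : unit_in [set: R] s <-> s \is a GRing.unit.
  split=> [[_ [t [_ st ts]]]|us]; first by apply/unitrP; exists t.
  by split=> //; exists s^-1; rewrite mulrV ?mulVr.
have [_ /(_ 1%N)] := coef_expands r.
have -> : ball_sum 1 (coef r) = emb (coef r 0).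
  rewrite -[RHS]mulr1 -(xmon0 x).
  have s0 : ball_sum 1 (fun=> 0) = 0.
    by rewrite /ball_sum big1 // => i _; rewrite rmorph0 mul0r.
  rewrite -[RHS]add0r -[X in X + _]s0 -[X in emb X]subr0.
  rewrite -(@ball_sum_update 1 (fun=> 0) 0) ?deg0 //.
  apply: eq_big_seq => alpha; rewrite mem_ball => al; case: eqP => [->//|[]].
  apply/ffunP => i; rewrite expo0; apply/eqP; rewrite -leqn0 -ltnS.
  by apply: leq_ltn_trans al; rewrite /deg (bigD1 i) //= leq_addr.
move=> m1; apply/idP/idP => [/unitE ur|r0].
  apply/eqP => r0; move: m1; rewrite r0 rmorph0 subr0 maxideal_pow1 //.
  by case.
apply/unitE; apply: contrapT => nur.
have mr : 'M^1 r by rewrite maxideal_pow1.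
have := asubB (addM 1%N) mr m1; rewrite subKr maxideal_pow1 // => -[_]; apply.
have rr : res (coef r 0) != 0 by rewrite res_eq0 //; exact: coef_digits.
rewrite -(iota_res_coef r 0); move: (res _) rr => b b0.
split=> //; exists (emb (iota b^-1)).
by rewrite -!rmorphM -!iotaM divff // mulVf // iota1 rmorph1.
Qed.

Lemma closed_spanD T r s :
  closed_span T r -> closed_span T s -> closed_span T (r + s).
Proof. by move=> Tr Ts l; apply: spannedD. Qed.

Lemma closed_span_scale T a r : closed_span T r -> closed_span T (emb a * r).
Proof.
move=> Tr l; have [s sT rs] := Tr l.
exists [seq (a * u.1, u.2) | u <- s]; first by move=> _ /mapP[u /sT + ->].
have := maxideal_pow_mull locR (a := emb a) I rs; congr ('M^l _).
rewrite mulrBr; congr (_ - _); rewrite big_map mulr_sumr.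
by apply: eq_bigr => u _; rewrite mulrA -rmorphM.
Qed.

(** Both factors are approximated by finite sums; since coefficients commute with monomials, only
    products of two monomials remain. *)
Lemma closed_spanM T T' T'' r s :
  (forall alpha beta, T alpha -> T' beta ->
    closed_span T'' (mon alpha * mon beta)) ->
  closed_span T r -> closed_span T' s -> closed_span T'' (r * s).
Proof.
move=> TT Tr Ts l; have [u uT ru] := Tr l; have [v vT sv] := Ts l.
set U := \sum_(w <- u) _ in ru; set V := \sum_(w <- v) _ in sv.
apply: (@spanned_congr _ _ _ _ _ _ _ _ _ (U * V)) => //.
  rewrite -[r * s](subrK (U * s)) -mulrBl -addrA -mulrBr.
  apply: asubD => //; first exact: maxideal_pow_mulr.
  exact: maxideal_pow_mull.
have span0 : spanned emb x [set: R] T'' l 0.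
  by exists [::] => //; rewrite big_nil subrr; exact: asub0.
have spanD a b : spanned emb x [set: R] T'' l a ->
  spanned emb x [set: R] T'' l b ->
  spanned emb x [set: R] T'' l (a + b) by exact: spannedD.
rewrite mulr_suml big_seq; apply: big_ind => // w wu.
rewrite mulr_sumr big_seq; apply: big_ind => // w' w'v.
rewrite mulrA -[_ * mon _ * _]mulrA emb_mon_comm !mulrA -rmorphM -mulrA.
by apply: closed_span_scale; apply: TT; [exact: uT|exact: vT].
Qed.

Lemma closed_spanS T T' r : T `<=` T' -> closed_span T r -> closed_span T' r.
Proof. by move=> TT' Tr l; have [s sT rs] := Tr l;
  exists s => // u /sT/TT'. Qed.

Lemma closed_span0 T : closed_span T 0.
Proof. by move=> l; exists [::] => //; rewrite big_nil subrr; exact: asub0. Qed.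

Lemma closed_span_term T a alpha : T alpha -> closed_span T (emb a * mon alpha).
Proof.
move=> Ta l; exists [:: (a, alpha)] => [u|]; first by rewrite inE => /eqP->.
by rewrite big_seq1 subrr; exact: asub0.
Qed.

Lemma coef_inj r s : (forall alpha, coef r alpha = coef s alpha) -> r = s.
Proof.
move=> /funext rs; apply/eqP; rewrite -subr_eq0; apply/eqP.
have [_ sep _] := complR; apply: sep => l.
have [_ /(_ l) er] := coef_expands r; have [_ /(_ l) es] := coef_expands s.
by apply: asub_trans er _ => //; apply: asub_sym => //; rewrite rs.
Qed.

(** * Leading monomials, division by [f] and the normal form *)

Section LeadingMonomials.
Variable le : rel (expo n).
Hypothesis le_mon : monomial_order emb iota x le.

Local Notation LM := (LM emb iota x le).

Let ord : additive_total_order le. Proof. by case: le_mon. Qed.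

Definition up gamma : set (expo n) := [set alpha | le gamma alpha].
Definition above gamma : set (expo n) := [set alpha | strict le gamma alpha].

Lemma above_up gamma : above gamma `<=` up gamma.
Proof. by move=> alpha; exact: ato_ltW. Qed.

Lemma above_irr gamma : ~ above gamma gamma.
Proof. by rewrite /above /= ato_ltNge // ato_refl. Qed.

Let le_addz alpha : le alpha (alpha + z).
Proof. by rewrite addrC; exact: ato_leDl. Qed.

Lemma up_carry_closed gamma : carry_closed (up gamma).
Proof. by move=> alpha ga; exact: ato_trans ord _ _ _ ga (le_addz alpha). Qed.

Lemma above_carry_closed gamma : carry_closed (above gamma).
Proof. by move=> alpha ga; exact: ato_lt_le ord _ _ _ ga (le_addz alpha). Qed.

Lemma closed_span_above gamma r :
  closed_span (up gamma) r -> coef r gamma = 0 -> closed_span (above gamma) r.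
Proof.
move=> /(closed_spanP _ (@up_carry_closed gamma)) ru r0.
apply/closed_spanP => [|alpha ra]; first exact: above_carry_closed.
rewrite /above /= /strict ru // andbT; apply: contraNneq ra => <-.
by rewrite r0.
Qed.

Lemma coef_above gamma r : closed_span (above gamma) r -> coef r gamma = 0.
Proof.
move=> /(closed_spanP _ (@above_carry_closed gamma)) ra; apply/eqP.
by apply: contrapT => /negP/ra/above_irr.
Qed.

Lemma lead_split gamma r : closed_span (up gamma) r ->
  exists2 r', r = emb (coef r gamma) * mon gamma + r' & closed_span (above gamma) r'.
Proof.
move=> ru; have [r1 [r2 [rE r1E r2E]]] := coef_split [set gamma] r.
exists r2.
  rewrite {1}rE; congr (_ + _); apply: coef_inj => alpha.
  rewrite r1E coef_term; last exact: coef_digits.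
  case: asboolP => [->|ne] /=; first by rewrite eqxx.
  by case: eqP => // e; case: ne.
apply: closed_span_above; last by rewrite r2E asboolT.
apply/closed_spanP => [|alpha]; first exact: up_carry_closed.
rewrite r2E; case: asboolP => [_|_]; first by rewrite eqxx.
exact: (proj1 (closed_spanP r (@up_carry_closed gamma)) ru alpha).
Qed.

(** The term vanishes or moves to [gamma + z], where [z] is nonzero because its degree is [1]. *)
Lemma closed_span_carry gamma e : res e = 0 ->
  closed_span (above gamma) (emb e * mon gamma).
Proof.
move=> /carryz[->|[z1 [b ->]]]; first by rewrite rmorph0 mul0r;
  exact: closed_span0.
apply: closed_span_term; rewrite /above /= -[X in strict _ X _]add0r [gamma + z]addrC.
apply: ato_ltD2r => //; case: (ord) => _ _ _ pos _; apply: pos.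
by apply: contra_eqN z1 => /eqP->; rewrite deg0.
Qed.

(** The substitute for additivity of [coef]: carries only go upwards, so nothing changes below
    [gamma], and at [gamma] the digits add up to an element of the kernel of [res]. *)
Lemma coef_add_up gamma r h : closed_span (up gamma) h ->
  (forall alpha, strict le alpha gamma -> coef (r + h) alpha = coef r alpha) /\
  res (coef (r + h) gamma) = res (coef r gamma) + res (coef h gamma).
Proof.
move=> hu.
(* [r1] is the part of [r] below [gamma]. Its support is disjoint from that of [r2 + h], so only the
   latter sum involves carries. *)
have [r1 [r2 [rE r1E r2E]]] := coef_split [set alpha | strict le alpha gamma] r.
have r2u : closed_span (up gamma) r2.
  apply/closed_spanP => [|alpha]; first exact: up_carry_closed.
  rewrite r2E; case: asboolP => [_|/negP]; first by rewrite eqxx.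
  by rewrite /up /= ato_ltNge // negbK.
have sumu : closed_span (up gamma) (r2 + h) by exact: closed_spanD.
have below s alpha : closed_span (up gamma) s -> strict le alpha gamma ->
    coef s alpha = 0.
  move=> /(closed_spanP _ (@up_carry_closed gamma)) su;
    rewrite ato_ltNge // => ag.
  by apply/eqP; apply: contraNT ag => /su.
have disj alpha : coef r1 alpha = 0 \/ coef (r2 + h) alpha = 0.
  rewrite r1E; case: asboolP => [ag|_]; last by left.
  by right; apply: below.
have sumE alpha : coef (r + h) alpha = coef r1 alpha + coef (r2 + h) alpha.
  by rewrite {1}rE -addrA; exact: coef_disjoint.
split=> [alpha ag|]; first by rewrite sumE r1E asboolT // (below (r2 + h)) // addr0.
have ngg : ~ [set alpha | strict le alpha gamma] gamma by exact: above_irr.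
rewrite sumE r1E asboolF // add0r.
have [r' r2s r'a] := lead_split r2u; have [h' hs h'a] := lead_split hu.
have -> : coef r gamma = coef r2 gamma by rewrite r2E asboolF.
(* [iota t] is the expected digit of [r2 + h] at [gamma]; the error [e] has residue [0], so its term
   moves strictly above [gamma]. *)
set t := RHS; pose e := coef r2 gamma + coef h gamma - iota t.
have e0 : res e = 0 by rewrite rmorphB rmorphD iotaK subrr.
set w := emb e * mon gamma + (r' + h').
have wa : closed_span (above gamma) w.
  by apply: closed_spanD; [exact: closed_span_carry|exact: closed_spanD].
have -> : r2 + h = emb (iota t) * mon gamma + w.
  rewrite {1}r2s {1}hs addrACA -mulrDl -rmorphD /w [RHS]addrA -mulrDl -rmorphD.
  by congr (emb _ * _ + _); rewrite /e [RHS]addrC subrK.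
rewrite coef_disjoint => [|alpha].
  rewrite coef_term; last exact: range_iota.
  by rewrite eqxx coef_above // addr0 iotaK.
rewrite coef_term; last exact: range_iota.
case: eqP => [->|_]; last by left.
by right; rewrite coef_above.
Qed.

Lemma LM_eq r alpha : coef r alpha != 0 -> (forall beta, coef r beta != 0 ->
  le alpha beta) ->
  LM r = alpha.
Proof.
move=> ra rmin; apply: xget_unique => // beta [rb bmin].
by apply: (ato_anti ord); [apply: bmin | apply: rmin].
Qed.

Lemma LM_min r : r != 0 ->
  coef r (LM r) != 0 /\ forall beta, coef r beta != 0 -> le (LM r) beta.
Proof.
move=> r0; have [|alpha ra rmin] := ato_min ord (X := [set alpha | coef r alpha != 0]).
  apply: contrapT => nr; move/eqP: r0; apply; apply: coef_eq0 => alpha.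
  by apply/eqP; apply: contrapT => /negP ra; apply: nr; exists alpha.
by rewrite (LM_eq ra).
Qed.

Lemma LM0 : LM 0 = 0.
Proof.
rewrite /Defs.LM; case: xgetP => // alpha _ [] /=.
by rewrite /supp /= coef_zero eqxx.
Qed.

Lemma closed_span_LM r : r != 0 -> closed_span (up (LM r)) r.
Proof.
by move=> /LM_min[_ rmin]; apply/closed_spanP; first exact: up_carry_closed.
Qed.

Lemma res_LM r : r != 0 -> res (coef r (LM r)) != 0.
Proof. by move=> /LM_min[rm _]; rewrite res_eq0 //; exact: coef_digits. Qed.

(** [LM 0] is the default [0], so a zero product would force [alpha + beta = 0]; but then both
    exponents are [0] and the product is [1]. *)
Lemma mon_mul_neq0 alpha beta : mon alpha * mon beta != 0.
Proof.
apply/eqP => ab0; case: le_mon => _ /(_ alpha beta);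
  rewrite ab0 LM0 => /esym ab.
have a0 : alpha = 0.
  apply/ffunP => i; move/ffunP: ab => /(_ i); rewrite expoD expo0 => /eqP.
  by rewrite addn_eq0 => /andP[/eqP].
move: ab ab0; rewrite a0 add0r => ->; rewrite xmon0 mulr1.
by move/eqP; rewrite oner_eq0.
Qed.

Lemma closed_span_mon_mul alpha beta :
  closed_span (up (alpha + beta)) (mon alpha * mon beta).
Proof.
by have [_ <-] := le_mon; apply: closed_span_LM; exact: mon_mul_neq0.
Qed.

Lemma upM gamma eta r s : closed_span (up gamma) r -> closed_span (up eta) s ->
  closed_span (up (gamma + eta)) (r * s).
Proof.
apply: closed_spanM => alpha beta ga eb;
  apply: closed_spanS (closed_span_mon_mul _ _).
move=> nu; apply: ato_trans => //; apply: (ato_trans ord (beta := alpha + eta)).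
  exact: ato_leD2r.
by rewrite ![alpha + _]addrC; exact: ato_leD2r.
Qed.

Lemma aboveM gamma eta r s : closed_span (above gamma) r ->
  closed_span (up eta) s ->
  closed_span (above (gamma + eta)) (r * s).
Proof.
apply: closed_spanM => alpha beta ga eb;
  apply: closed_spanS (closed_span_mon_mul _ _).
move=> nu; apply: ato_lt_le => //; apply: (ato_lt_le ord (beta := alpha + eta)).
  exact: ato_ltD2r.
by rewrite ![alpha + _]addrC; exact: ato_leD2r.
Qed.

Lemma upMabove gamma eta r s : closed_span (up gamma) r ->
  closed_span (above eta) s ->
  closed_span (above (gamma + eta)) (r * s).
Proof.
apply: closed_spanM => alpha beta ga eb;
  apply: closed_spanS (closed_span_mon_mul _ _).
move=> nu; apply: ato_lt_le => //; apply: (ato_le_lt ord (beta := alpha + eta)).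
  exact: ato_leD2r.
by rewrite ![alpha + _]addrC; exact: ato_ltD2r.
Qed.

(** The leading terms multiply to the digit [iota (res a * res b)] times [mon gamma * mon eta],
    whose digit at [gamma + eta] is nonzero for a monomial order; all other contributions lie
    strictly above. *)
Lemma lead_mul gamma eta r s : closed_span (up gamma) r ->
  closed_span (up eta) s ->
  res (coef r gamma) != 0 -> res (coef s eta) != 0 ->
  res (coef (r * s) (gamma + eta)) != 0.
Proof.
move=> ru su r0 s0; have [r' rE r'a] := lead_split ru.
have [s' sE s'a] := lead_split su.
set a := coef r gamma in rE r0; set b := coef s eta in sE s0.
have ab : a * b = iota (res a * res b) by rewrite iotaM !iota_res_coef.
pose w := emb a * mon gamma * s' + r' * s.
have wa : closed_span (above (gamma + eta)) w.
  apply: closed_spanD; last exact: aboveM.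
  by apply: upMabove => //; apply: closed_span_term; exact: ato_refl.
have -> : r * s = emb (a * b) * (mon gamma * mon eta) + w.
  rewrite {1}rE mulrDl {1}sE mulrDr /w addrA; congr (_ + _ + _).
  by rewrite rmorphM -!mulrA; congr (_ * _); rewrite !mulrA emb_mon_comm.
have [_ ->] := coef_add_up (emb (a * b) * (mon gamma * mon eta))
  (closed_spanS (@above_up _) wa).
rewrite (coef_above wa) rmorph0 addr0 ab coef_scale rmorphM iotaK !mulf_neq0 //.
by case: le_mon => _ <-; apply: res_LM; exact: mon_mul_neq0.
Qed.

Lemma LM_mul q f : q != 0 -> f != 0 -> LM (q * f) = LM q + LM f.
Proof.
move=> q0 f0; have qu := closed_span_LM q0; have fu := closed_span_LM f0.
apply: LM_eq; last exact/(closed_spanP _ (@up_carry_closed _))/upM.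
by rewrite -res_eq0; [apply: lead_mul => //;
  exact: res_LM | exact: coef_digits].
Qed.

Lemma mul_neq0 (q f : R) : q != 0 -> f != 0 -> q * f != 0.
Proof.
move=> q0 f0; apply/eqP => qf0.
have := lead_mul (closed_span_LM q0) (closed_span_LM f0) (res_LM q0) (res_LM f0).
by rewrite qf0 coef_zero rmorph0 eqxx.
Qed.

Lemma LM_unit u : u \is a GRing.unit -> LM u = 0.
Proof.
by rewrite unit_coef0 => u0; apply: LM_eq => // beta _; exact: ato_le0.
Qed.

Lemma LM_unit_mul u f : u \is a GRing.unit -> f != 0 -> LM (u * f) = LM f.
Proof.
move=> uu f0; have u0 : u != 0 by apply: contraTneq uu => ->; rewrite unitr0.
by rewrite LM_mul // LM_unit // add0r.
Qed.

(** By [coef_add_up] applied to [g' + (g - g')], the residues of the two digits differ by that of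
    the leading digit of [g - g'], which is nonzero. *)
Lemma coef_LM_sub g g' : g != g' ->
  coef g (LM (g - g')) != coef g' (LM (g - g')).
Proof.
rewrite -subr_eq0 => gg'; have gu := closed_span_LM gg'.
have [_ +] := coef_add_up g' gu; rewrite addrC subrK => e.
apply/eqP => gE; have /eqP := res_LM gg'; apply.
by apply: (addrI (res (coef g' (LM (g - g'))))); rewrite -e gE addr0.
Qed.

(** The digits [d] of [q] are found by recursion along the order: the part of [q] below [beta]
    contributes a known residue at [beta + LM f], the part above does not reach that exponent, and
    [d beta] makes up the difference to [tau beta]. *)
Lemma weierstrass_division f (tau : expo n -> k) : f != 0 ->
  exists q, forall beta, coef (q * f) (beta + LM f) = iota (tau beta).
Proof.
move=> f0; pose mu := LM f; have fu := closed_span_LM f0.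
have /choice[ser serE] (d : expo n -> k) :
    exists r, coef r = fun alpha => iota (d alpha).
  by apply: digits_series => alpha; exact: range_iota.
have monu beta : closed_span (up beta) (mon beta).
  by rewrite -[mon beta]mul1r -(rmorph1 emb); apply: closed_span_term;
    exact: ato_refl.
(* The factor by which the digit of [q] at [beta] enters the residue at [beta + mu]; the recursion
   divides by it. *)
pose rho beta := res (coef (mon beta * f) (beta + mu)).
have rho0 beta : rho beta != 0.
  apply: (lead_mul (monu beta) fu); last exact: res_LM.
  rewrite -[mon beta]mul1r -(rmorph1 emb) coef_term; last by rewrite -iota1;
    exact: range_iota.
  by rewrite eqxx rmorph1 oner_neq0.
have [d dE] := ato_rec ord (0 : k) (fun beta d' =>
  (tau beta - res (coef (ser d' * f) (beta + mu))) / rho beta).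
exists (ser d) => beta; rewrite -/mu -[LHS]iota_res_coef; congr iota.
have [q1 [q2 [qE q1E q2E]]] := coef_split [set alpha | strict le alpha beta] (ser d).
have nbb : ~ [set alpha | strict le alpha beta] beta by exact: above_irr.
(* Thanks to the filler [0], [q1] is the very series that the recursion formula evaluates at
   [beta]. *)
have q1ser : q1 = ser (fun gamma => if strict le gamma beta then d gamma else 0).
  apply: coef_inj => alpha; rewrite q1E !serE.
  by case: asboolP => /= [->//|/negP/negPf->]; rewrite iota0.
have q2u : closed_span (up beta) q2.
  apply/closed_spanP => [|alpha]; first exact: up_carry_closed.
  rewrite q2E; case: asboolP => [_|/negP]; first by rewrite eqxx.
  by rewrite /up /= ato_ltNge // negbK.
have [q' q2s q'a] := lead_split q2u.
have q2b : coef q2 beta = iota (d beta) by rewrite q2E asboolF // serE.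
rewrite {1}qE mulrDl.
have [_ ->] := coef_add_up (q1 * f) (upM q2u fu).
rewrite {1}q2s mulrDl q2b -mulrA.
have q'f := aboveM q'a fu.
have [_ ->] := coef_add_up (emb (iota (d beta)) * (mon beta * f))
  (closed_spanS (@above_up _) q'f).
rewrite (coef_above q'f) rmorph0 addr0 coef_scale rmorphM iotaK -/(rho beta).
by rewrite [d beta]dE divfK // q1ser addrC subrK.
Qed.

Lemma normal_form f : f != 0 -> exists! uF : R * R, let: (u, F) := uF in
  [/\ u \is a GRing.unit, f = u * F, LC emb iota x le F = 1 &
    supp emb iota x F `&` [set LM f + gamma | gamma in [set: expo n]] = [set LM f]].
Proof.
move=> f0; set mu := LM f; set D := [set mu + gamma | gamma in _].
(* With the indicator of [0] as [tau], the digits of [q * f] on [D] are [1] at [mu] and [0]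
   elsewhere. *)
have [q qE] := weierstrass_division (fun beta => (beta == 0)%:R) f0.
have iotaE (b : bool) : iota b%:R = b%:R by case: b;
  [exact: iota1|exact: iota0].
have qfmu : coef (q * f) mu = 1 by have := qE 0; rewrite add0r eqxx iotaE.
have qf0 : q * f != 0.
  by apply: contra_eq_neq qfmu => ->; rewrite coef_zero eq_sym oner_neq0.
have q0 : q != 0 by apply: contraNneq qf0 => ->; rewrite mul0r.
(* The leading digit of [q * f] sits at [LM q + mu], a point of [D], where only [mu] carries a
   nonzero digit. *)
have LMq : LM q = 0.
  have [+ _] := LM_min qf0.
  by rewrite LM_mul // qE iotaE; case: (LM q =P 0) => // _; rewrite eqxx.
have uq : q \is a GRing.unit by rewrite unit_coef0 -LMq; case: (LM_min q0).
have LMqf : LM (q * f) = mu by exact: LM_unit_mul.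
exists (q^-1, q * f); split.
  split; [by rewrite unitrV | by rewrite mulKr | by rewrite /LC LMqf |].
  apply/seteqP; split=> [alpha [+ [gamma _ ag]]|_ ->] /=.
    rewrite -ag /supp /= addrC qE iotaE; case: (gamma =P 0) => [->|_];
      first by rewrite add0r.
    by rewrite eqxx.
  by split; [rewrite /supp /= qfmu oner_eq0 | exists 0; rewrite ?addr0].
move=> [u F] [uu fuF LCF sF].
have F0 : F != 0 by apply: contraNneq f0 => F0; rewrite fuF F0 mulr0.
have LMF : LM F = mu by rewrite /mu fuF LM_unit_mul.
(* Conditions (ii) and (iii) determine the digits of [F] on [D]: they are those of [q * f]. *)
have FE gamma : coef F (mu + gamma) = (gamma == 0)%:R.
  case: eqP => [->|g0]; first by rewrite addr0 -LMF.
  apply/eqP; apply: contrapT => /negP Fg; apply: g0.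
  have : (supp emb iota x F `&` D) (mu + gamma) by split=> //; exists gamma.
  rewrite sF => /ffunP mug; apply/ffunP => i; have := mug i.
  by rewrite expoD expo0 -[RHS]addn0 => /addnI.
(* This yields both [F = q * f] and [u = q^-1]. *)
suff qu : q * u = 1.
  by rewrite fuF mulrA qu mul1r -[u]mul1r -(mulVr uq) -mulrA qu mulr1.
apply/eqP; rewrite -subr_eq0; apply: contrapT => /negP v0.
(* If [q * u - 1] were nonzero, the leading exponent of this difference would be
   [LM (q * u - 1) + mu], a point of [D], where the digits of [q * f] and [F] agree. *)
have dE : q * f - F = (q * u - 1) * F by rewrite mulrBl mul1r fuF mulrA.
have d0 : q * f != F by rewrite -subr_eq0 dE mul_neq0.
have := coef_LM_sub d0; rewrite dE LM_mul // LMF addrC FE addrC qE iotaE.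
by rewrite eqxx.
Qed.

End LeadingMonomials.

End Expansions.

Theorem corollary5p6 (k : finFieldType) (p : nat) (hp : p \in [pchar k])
    (A : idomainType) (R : unitRingType)
    (emb : {rmorphism A -> R}) (res : {rmorphism A -> k}) (iota : k -> A)
    (n : nat) (x : 'I_n -> R)
    (hR : type_A emb res x \/ type_B emb res x)
    (hiota : multiplicative_section res iota)
    (le : rel {ffun 'I_n -> nat}) (hle : monomial_order emb iota x le)
    (f : R) (hf : f != 0) :
  (exists! uF : R * R, let: (u, F) := uF in
     [/\ u \is a GRing.unit, f = u * F,
         LC emb iota x le F = 1 &
         supp emb iota x F `&` [set LM emb iota x le f + gamma | gamma in [set: {ffun 'I_n -> nat}]]
         = [set LM emb iota x le f]])
  /\ (forall u F : R, u \is a GRing.unit -> f = u * F ->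
        LM emb iota x le f = LM emb iota x le F).
Proof.
(* Both types provide the same three facts, after which they are no longer distinguished; type (A)
   takes [z = 0]. *)
have [z [basis central carryz]] : exists z : expo n,
    [/\ monomial_basis emb res x [set: R] n,
        forall i a, x i * emb a = emb a * x i & carries emb res x z].
  by case: hR => [/type_A_basis H|/type_B_basis//]; exists 0.
split; first exact: (normal_form basis central carryz hiota hle).
move=> u F uu fE; rewrite fE (LM_unit_mul basis central carryz hiota hle) //.
by apply: contraNneq hf => F0; rewrite fE F0 mulr0.
Qed.
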